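(* Let $g>0$. For every wave number $k_0>0$ there exist $M_\infty>0$ and a function $h_\infty$ with $h_\infty\in W^{2,p}_{\mathrm{per}}$ for all $p\in[1,\infty)$ and $\partial_x^3h_\infty\in L^2_{\mathrm{loc}}(\{h_\infty>0\})$ such that $h_\infty$ is a weak stationary solution (in the sense defined in the context) of $$\partial_x\Bigl(h_\infty^3\bigl(\partial_x^3h_\infty-g\,\partial_xh_\infty\bigr)+M_\infty\frac{h_\infty^2}{(1+h_\infty)^2}\partial_xh_\infty\Bigr)=0 .$$ Moreover, $h_\infty$ is even, $\tfrac{2\pi}{k_0}$-periodic, non-decreasing on $[-\tfrac{\pi}{k_0},0)$, and $h_\infty\ge0$ with $h_\infty(x)=0$ precisely at the points $x=\pm\tfrac{\pi}{k_0}+2j\tfrac{\pi}{k_0}$, $j\in\mathbb{Z}$. The nonlinear flux $$h_\infty^3\bigl(\partial_x^3h_\infty-g\,\partial_xh_\infty\bigr)+M_\infty\frac{h_\infty^2}{(1+h_\infty)^2}\partial_xh_\infty$$ can be continuously extended into the set $\{h_\infty=0\}$ and vanishes everywhere.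
   Context: $W^{2,p}_{\mathrm{per}}$ denotes the space of $\tfrac{2\pi}{k_0}$-periodic functions in $W^{2,p}_{\mathrm{loc}}(\mathbb{R})$. $\{h>0\}=\{x\in\mathbb{R}:h(x)>0\}$. Weak stationary solution: for $M\in\mathbb{R}$, a function $h\in H^1_{\mathrm{loc}}(\mathbb{R})$ with $\partial_x^3h\in L^2_{\mathrm{loc}}(\{h>0\})$ and $h^3(\partial_x^3h-g\,\partial_xh)+M\frac{h^2}{(1+h)^2}\partial_xh\in L^2_{\mathrm{loc}}(\mathbb{R})$ is a weak stationary solution to the thin-film equation $\partial_t h+\partial_x\bigl(h^3(\partial_x^3h-g\partial_xh)+M\frac{h^2}{(1+h)^2}\partial_xh\bigr)=0$ if $$\int_{\{h>0\}}\Bigl(h^3(\partial_x^3h-g\,\partial_xh)+M\frac{h^2}{(1+h)^2}\partial_xh\Bigr)\partial_x\varphi\,\mathrm{d}x=0$$ for all $\varphi\in H^1(\mathbb{R})$ with compact support. *)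

(* Defs.v *)
From HB Require Import structures.
From mathcomp Require Export all_boot all_order all_algebra.
From mathcomp Require Export all_classical all_reals all_analysis.
Export Order.TTheory GRing.Theory Num.Theory.
Export numFieldNormedType.Exports.

Set Implicit Arguments.
Unset Strict Implicit.
Unset Printing Implicit Defensive.

Local Open Scope classical_set_scope.
Local Open Scope ring_scope.

(* phi is in C_c^oo(U) *)
Definition test_function {R : realType} (U : set R) (phi : R -> R) : Prop :=
  [/\ forall (n : nat) (x : R), derivable (derive1n n phi) x 1,
      compact (closure [set x | phi x != 0]) &
      closure [set x | phi x != 0] `<=` U].

(* d represents the distributional derivative of order n of f on U.
   [locally_integrable U _] contains the requirement that U is open.
   Both sides of the identity are integrals of integrable functions, so no
   indeterminate extended-real expression arises. *)
Definition weak_derivative {R : realType} (U : set R) (n : nat)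
    (f d : R -> R) : Prop :=
  [/\ locally_integrable U f, locally_integrable U d &
      forall phi : R -> R, test_function U phi ->
        (\int[lebesgue_measure]_(x in U) (f x * derive1n n phi x)%:E =
         ((-1) ^+ n)%:E * \int[lebesgue_measure]_(x in U) (d x * phi x)%:E)%E].

(* Functions are taken pointwise (not modulo null sets); [f \_ K] extends the
   restriction of f to K by 0. *)
Definition Lp_loc {R : realType} (U : set R) (p : R) (f : R -> R) : Prop :=
  forall K : set R, K `<=` U -> compact K ->
    (f \_ K : R -> R) \in Lfun (@lebesgue_measure R) p%:E.

Definition sobolev_loc {R : realType} (U : set R) (m : nat) (p : R)
    (f : R -> R) : Prop :=
  forall n : nat, (n <= m)%N ->
    exists2 d : R -> R, weak_derivative U n f d & Lp_loc U p d.

(* T is the period *)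
Definition sobolev_per {R : realType} (T : R) (m : nat) (p : R)
    (f : R -> R) : Prop :=
  sobolev_loc setT m p f /\ periodic f T.

(* phi is in H^1(R) with weak derivative dphi, and has compact essential
   support *)
Definition H1_compact {R : realType} (phi dphi : R -> R) : Prop :=
  [/\ phi \in Lfun (@lebesgue_measure R) 2%:E,
      dphi \in Lfun (@lebesgue_measure R) 2%:E,
      weak_derivative setT 1 phi dphi &
      exists2 K : set R, compact K &
        {ae lebesgue_measure, forall x, ~ K x -> phi x = 0}].

Definition positivity_set {R : realType} (h : R -> R) : set R :=
  [set x | 0 < h x].

(* h1 and h3 stand for the first and third derivative of h *)
Definition flux {R : realType} (g M : R) (h h1 h3 : R -> R) (x : R) : R :=
  h x ^+ 3 * (h3 x - g * h1 x) + M * (h x ^+ 2 / (1 + h x) ^+ 2) * h1 x.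

(* h1 and h3 represent the weak derivatives h' on the line and h''' on
   {h > 0} *)
Definition film_derivatives {R : realType} (h h1 h3 : R -> R) : Prop :=
  weak_derivative setT 1 h h1 /\ weak_derivative (positivity_set h) 3 h h3.

(* h is the continuous representative of its class in H^1_loc, so that {h > 0}
   is a well-defined open set.  As h''' lives on {h > 0} only, the flux is
   understood as 0 off that set. *)
Definition weak_stationary_solution {R : realType} (g M : R) (h : R -> R) :
    Prop :=
  [/\ continuous h,
      sobolev_loc setT 1 2 h &
      exists h1 h3 : R -> R,
        [/\ film_derivatives h h1 h3,
            Lp_loc (positivity_set h) 2 h3,
            Lp_loc setT 2 (flux g M h h1 h3 \_ (positivity_set h)) &
            forall phi dphi : R -> R, H1_compact phi dphi ->
              (\int[lebesgue_measure]_(x in positivity_set h)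
                 (flux g M h h1 h3 x * dphi x)%:E = 0)%E]].

(* Main.v *)
(* Where h > 0, dividing the flux by h^3 and integrating twice gives the energy
   identity h'^2 = 2 h (M ell(h) - g (1 - h) / 2) with ell(h) = ln ((1 + h) / (2 h)),
   for the normalization max h = 1 and h' = 0 where h = 0.  Substituting
   h = cos(t)^2 turns it into dx/dt = wfun g M t with wfun continuous,
   pi-periodic, and zero exactly where cos t = 0, so that x = X(t) is a
   homeomorphism of the line and h(x) = cos(X^-1(x))^2 is periodic with half
   period T(M), the integral of wfun over [0, pi/2].  T(M) tends to +oo as M
   decreases to g and to 0 as M grows, hence T(M) = pi/k0 for some M.  At the
   zeros of h the second derivative has only a logarithmic singularity. *)
Require Import Defs.
From mathcomp Require Import ring lra zify measurable_realfun.

Set Implicit Arguments.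
Unset Strict Implicit.
Unset Printing Implicit Defensive.

Local Open Scope classical_set_scope.
Local Open Scope ring_scope.

(** * Calculus on the line *)

(** One integration of the zero-flux equation gives h'' = [curv g M h], with the free constant
    chosen so that the energy vanishes at the crest h = 1; the second constant is 0 because h' = 0
    where h = 0. The condition M > g says that h'' = (g - M) / 2 is negative at the crest. At M = g
    the crest height becomes a rest point, hence the blow-up of T(M). The angle t cancels the factor
    1 - h at the crest and the factor h at the zeros, so one formula covers the rising and falling
    branches. What is left is the quotient (1 - h) / ell(h), shown only to be continuous at h = 0
    and h = 1. Two obstacles follow: X^-1 has infinite slope at the zeros, and the slope h' cannot
    be differentiated through t at the crests by the usual quotient rule. So h' is found by
    comparing primitives, and h'' by differentiating the energy identity away from the crests and by
    a weaker product rule at them. Since h' is continuous and vanishes at the zeros, integrating by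
    parts between consecutive zeros leaves no point masses, and h'' is a weak derivative on the
    whole line. *)

Lemma is_derive_continuous (R : realType) (f : R -> R) (x l : R) :
  is_derive x 1 f l -> {for x, continuous f}.
Proof.
by move=> [/derivable1_diffP df _]; exact: differentiable_continuous.
Qed.

Lemma is_derive_add (R : realType) (f g : R -> R) (x a b : R) :
  is_derive x 1 f a -> is_derive x 1 g b ->
  is_derive x 1 (fun y => f y + g y) (a + b).
Proof. exact: is_deriveD. Qed.

Lemma is_derive_sub (R : realType) (f g : R -> R) (x a b : R) :
  is_derive x 1 f a -> is_derive x 1 g b ->
  is_derive x 1 (fun y => f y - g y) (a - b).
Proof. exact: is_deriveB. Qed.

Lemma is_derive_mul (R : realType) (f g : R -> R) (x a b : R) :
  is_derive x 1 f a -> is_derive x 1 g b ->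
  is_derive x 1 (fun y => f y * g y) (a * g x + f x * b).
Proof.
move=> df dg; have := is_deriveM df dg.
by rewrite /GRing.scale/= addrC [g x * a]mulrC.
Qed.

Lemma is_derive_scale (R : realType) (f : R -> R) (x a k : R) :
  is_derive x 1 f a -> is_derive x 1 (fun y => k * f y) (k * a).
Proof.
by move=> df; have := is_derive_mul (is_derive_cst k x 1) df; rewrite mul0r add0r.
Qed.

Lemma is_derive_inv (R : realType) (f : R -> R) (x a : R) : f x != 0 ->
  is_derive x 1 f a -> is_derive x 1 (fun y => (f y)^-1) (- (f x ^- 2) * a).
Proof. by move=> fx df; exact: (is_deriveV fx df). Qed.

Lemma is_derive_comp (R : realType) (f g : R -> R) (x a b : R) :
  is_derive x 1 g b -> is_derive (g x) 1 f a ->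
  is_derive x 1 (fun y => f (g y)) (a * b).
Proof. by move=> dg df; exact: (@is_derive1_comp R f g x a b df dg). Qed.

Lemma continuous_at_comp (R : realType) (f g : R -> R) (x : R) :
  {for x, continuous g} -> {for g x, continuous f} ->
  {for x, continuous (fun y => f (g y))}.
Proof. by move=> cg cf; exact: (continuous_comp cg cf). Qed.

Lemma continuous_at_sub (R : realType) (f g : R -> R) (x : R) :
  {for x, continuous f} -> {for x, continuous g} ->
  {for x, continuous (fun y => f y - g y)}.
Proof. by move=> cf cg; exact: (continuousB cf cg). Qed.

Lemma continuous_at_mul (R : realType) (f g : R -> R) (x : R) :
  {for x, continuous f} -> {for x, continuous g} ->
  {for x, continuous (fun y => f y * g y)}.
Proof. by move=> cf cg; exact: (continuousM cf cg). Qed.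

Lemma is_derive_of_derive1 (R : realType) (f : R -> R) (x l : R) :
  derivable f x 1 -> (f^`())%classic x = l -> is_derive x 1 f l.
Proof. by move=> df <-; rewrite derive1E; exact: derivableP. Qed.

Lemma primitive_unique (R : realType) (F G d : R -> R) (x y : R) :
  (forall x : R, is_derive x 1 F (d x)) -> (forall x : R, is_derive x 1 G (d x)) ->
  F x - F y = G x - G y.
Proof.
move=> dF dG.
have /(_ x y) : forall x y, (F - G) x = (F - G) y.
  move=> {}x {}y; apply: is_derive_0_is_cst => z.
  by rewrite -(subrr (d z)); exact: is_deriveB.
by rewrite !fctE => /(congr1 (fun z => z + G x - F y)); lra.
Qed.

Lemma cst_of_derive0 (R : realType) (F : R -> R) (a b : R) : a <= b ->
  {within `[a, b], continuous F} ->
  (forall x : R, a < x < b -> is_derive x 1 F 0) -> F b = F a.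
Proof.
move=> ab cF dF.
have dF0 x : x \in `]a, b[ -> is_derive x 1 F 0 by rewrite in_itv; exact: dF.
have [c _] := MVT_segment ab dF0 cF.
by rewrite mul0r => /eqP; rewrite subr_eq0 => /eqP.
Qed.

Lemma EFin_Rintegral d (T : measurableType d) (R : realType)
    (mu : {measure set T -> \bar R}) (D : set T) (f : T -> R) :
  measurable D -> mu.-integrable D (EFin \o f) ->
  (\int[mu]_(x in D) (f x)%:E)%E = (\int[mu]_(x in D) f x)%:E.
Proof. by move=> mD fi; rewrite /Rintegral fineK//; exact: integrable_fin_num. Qed.

Lemma integrable_setU d (T : measurableType d) (R : realType)
    (mu : {measure set T -> \bar R}) (A B : set T) (f : T -> \bar R) :
  measurable A -> measurable B -> [disjoint A & B] ->
  mu.-integrable A f -> mu.-integrable B f -> mu.-integrable (A `|` B) f.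
Proof.
move=> mA mB AB /integrableP[mfA fA] /integrableP[mfB fB].
apply/integrableP.
have mf := proj2 (measurable_funU _ mA mB) (conj mfA mfB).
split => //; rewrite ge0_integral_setU//; first exact: lte_add_pinfty.
by apply: measurableT_comp mf.
Qed.

Lemma integrable_dominated d (T : measurableType d) (R : realType)
    (mu : {measure set T -> \bar R}) (D : set T) (f g : T -> R) (k : R) :
  measurable D -> measurable_fun D f ->
  (forall x, D x -> `|f x| <= k * g x) ->
  mu.-integrable D (EFin \o g) -> mu.-integrable D (EFin \o f).
Proof.
move=> mD mf fg gi; apply: (le_integrable mD _ _ (integrableZl mD k gi)).
  exact/measurable_EFinP.
by move=> x Dx; rewrite lee_fin (le_trans (fg x Dx))// ler_norm.
Qed.

Lemma ge0_derive_le (R : realType) (F f : R -> R) (a b : R) : a <= b ->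
  {within `[a, b], continuous F} ->
  (forall x : R, a < x < b -> is_derive x 1 F (f x)) ->
  (forall x : R, a < x < b -> 0 <= f x) -> F a <= F b.
Proof.
rewrite le_eqVlt => /predU1P[->//|ab] cF dF f0.
have dF0 x : x \in `]a, b[ -> is_derive x 1 F (f x) by rewrite in_itv; exact: dF.
have [c cab] := MVT ab dF0 cF.
rewrite -subr_ge0 => ->; rewrite mulr_ge0 ?subr_ge0 ?(ltW ab)//.
by apply: f0; move: cab; rewrite in_itv.
Qed.

Lemma continuous_integrable_itv (R : realType) (f : R -> R) (a b : R) :
  continuous f -> (@lebesgue_measure R).-integrable `[a, b] (EFin \o f).
Proof.
move=> cf; apply: continuous_compact_integrable; first exact: segment_compact.
exact: continuous_subspaceT.
Qed.

(** The oriented integral from 0 is emulated by two integrals, at least one of which is over an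
    empty interval. Near [x] it differs by a constant from the integral started at the far point
    [- A], to which the fundamental theorem applies. *)
Lemma exists_primitive (R : realType) (w : R -> R) :
  continuous w -> exists W : R -> R, forall x : R, is_derive x 1 W (w x).
Proof.
move=> cw.
pose W (x : R) : R := \int[lebesgue_measure]_(t in `]0, x]) w t -
            \int[lebesgue_measure]_(t in `]x, 0]) w t.
exists W => x.
pose A : R := `|x| + 1.
pose P (y : R) : R := \int[lebesgue_measure]_(t in `[- A, y]) w t.
have A0 : 0 < A by rewrite /A ltr_wpDl.
have xA : - A < x < A by rewrite -ltr_norml /A ltrDl.
have /andP[Ax xA'] := xA.
have dP : is_derive x 1 P (w x).
  have [] := continuous_FTC1_closed xA'
    (@continuous_integrable_itv _ _ (- A) A cw) Ax (cw x).
  exact: is_derive_of_derive1.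
have PW : \forall y \near x, P y - P 0 = W y.
  have : \forall y \near x, y \in `](- A), A[ by apply: near_in_itvoo; rewrite in_itv.
  apply: filterS => y; rewrite in_itv/= => /andP[Ay yA].
  rewrite /P /W; have [y0|y0] := leP 0 y.
    rewrite (@Rintegral_itvB _ _ (BLeft (- A)) (BRight y) 0)//=; last 2 first.
    - exact: continuous_integrable_itv.
    - by rewrite bnd_simp oppr_le0 ltW.
    rewrite [X in _ = _ - X](_ : _ = 0) ?subr0//.
    by rewrite set_itv_ge ?Rintegral_set0// bnd_simp -leNgt.
  rewrite [X in _ = X - _](_ : _ = 0); last first.
    by rewrite set_itv_ge ?Rintegral_set0// bnd_simp -leNgt ltW.
  rewrite sub0r -opprB (@Rintegral_itvB _ _ (BLeft (- A)) (BRight 0) y)//=.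
  - exact: continuous_integrable_itv.
  - by rewrite bnd_simp ltW.
  - by rewrite bnd_simp ltW.
apply: near_eq_is_derive PW _.
rewrite -[w x]subr0; apply: is_deriveB.
Qed.

Lemma within_continuous_itv (R : realType) (F : R -> R) (a b c d : R) :
  a <= c -> d <= b ->
  {within `[a, b], continuous F} -> {within `[c, d], continuous F}.
Proof.
move=> ac db; apply: continuous_subspaceW.
by apply: subset_itvScc; rewrite bnd_simp.
Qed.

(** The integrand may be unbounded at both ends: integrability makes its indefinite integral
    continuous on the closed interval, and [F] minus that integral has zero derivative inside. *)
Lemma improper_FTC (R : realType) (F f : R -> R) (a b : R) : a < b ->
  (@lebesgue_measure R).-integrable `[a, b] (EFin \o f) ->
  {within `[a, b], continuous F} ->
  (forall x : R, a < x < b -> is_derive x 1 F (f x)) ->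
  (forall x : R, a < x < b -> {for x, continuous f}) ->
  \int[lebesgue_measure]_(x in `[a, b]) f x = F b - F a.
Proof.
move=> ab fi cF dF cf.
pose P (x : R) : R := \int[lebesgue_measure]_(t in `[a, x]) f t.
have cP : {within `[a, b], continuous P}.
  by apply: parameterized_integral_continuous => //; exact: ltW.
have cG : {within `[a, b], continuous (F - P)}.
  by move=> x; exact: (continuousB (cF x) (cP x)).
have := cst_of_derive0 (ltW ab) cG.
have P0 : P a = 0 by rewrite /P set_itv1 Rintegral_set1.
rewrite !fctE P0 subr0 => H.
  rewrite -[F a]H; first by rewrite opprB addrC subrK.
move=> x xab; have /andP[ax xb] := xab.
rewrite -(subrr (f x)); apply: is_deriveB; first exact: dF.
have [] := @continuous_FTC1_closed R f a x b xb fi ax (cf _ xab).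
exact: is_derive_of_derive1.
Qed.

(** Integrability of [e] up to the end points is not known in advance, so [improper_FTC] is used on
    compact subintervals and monotone convergence passes to the limit. A primitive that stays
    continuous at the ends thus proves integrability of its derivative. *)
Lemma ge0_improper_integral_le (R : realType) (E e : R -> R) (a b : R) : a < b ->
  {within `[a, b], continuous E} ->
  (forall x : R, a < x < b -> is_derive x 1 E (e x)) ->
  (forall x : R, a < x < b -> {for x, continuous e}) ->
  (forall x : R, a < x < b -> 0 <= e x) ->
  (\int[lebesgue_measure]_(x in `]a, b[) (e x)%:E <= (E b - E a)%:E)%E.
Proof.
move=> ab cE dE ce e0.
(* The shift by 3 keeps the two margins together below [b - a], so the subinterval is nondegenerate
   already for n = 0. *)
pose d (n : nat) := (b - a) / n.+3%:R.
have d0 n : 0 < d n by rewrite divr_gt0// subr_gt0.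
have dn n : a + d n < b - d n.
  rewrite -subr_gt0 [X in 0 < X](_ : _ = (b - a) * (1 - 2 / n.+3%:R)); last first.
    by rewrite /d; field; rewrite lt0r_neq0//; have := ler0n R n; lra.
  rewrite mulr_gt0 ?subr_gt0// ltr_pdivrMr// mul1r ltr_nat//.
have hd m n : (m <= n)%N -> d n <= d m.
  move=> mn; rewrite /d ler_pM2l ?subr_gt0// lef_pV2 ?posrE// ler_nat.
  by rewrite !ltnS.
pose F n : set R := `[a + d n, b - d n]%classic.
have FU : \bigcup_n F n = `]a, b[%classic.
  apply/seteqP; split => x.
    move=> [n _]; rewrite /F /= !in_itv/= => /andP[h1 h2].
    rewrite (lt_le_trans _ h1) ?ltrDl//= (le_lt_trans h2)//.
    by rewrite ltrBlDr ltrDl.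
  rewrite /= in_itv/= => /andP[ax xb].
  pose m := Num.min (x - a) (b - x).
  have m0 : 0 < m by rewrite lt_min !subr_gt0 ax xb.
  have [n nm] : exists n : nat, (b - a) / m < n%:R.
    by exists (Num.Def.truncn ((b - a) / m)).+1; exact: truncnS_gt.
  have dm : d n <= m.
    rewrite /d ler_pdivrMr// mulrC -ler_pdivrMr// (le_trans (ltW nm))//.
    by rewrite ler_nat; lia.
  exists n => //; rewrite /F /= in_itv/=.
  move: dm; rewrite /m le_min => /andP[h1 h2].
  by apply/andP; split; lra.
have Fs n x : F n x -> a < x < b.
  move=> Fx; have : (\bigcup_n F n) x by exists n.
  by rewrite FU /= in_itv.
have cef n : {within F n, continuous e}.
  apply: continuous_in_subspaceT => x; rewrite inE => /Fs.
  exact: ce.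
rewrite -FU.
have IF n : (\int[lebesgue_measure]_(x in F n) (e x)%:E <= (E b - E a)%:E)%E.
  have [h1 h2] := (d0 n, dn n).
  have ei : (@lebesgue_measure R).-integrable (F n) (EFin \o e).
    by apply: continuous_compact_integrable => //; exact: segment_compact.
  have -> : (\int[lebesgue_measure]_(x in F n) (e x)%:E =
             (\int[lebesgue_measure]_(x in F n) e x)%:E)%E.
    by apply: EFin_Rintegral => //; exact: measurable_itv.
  have sub x : a + d n < x < b - d n -> a < x < b.
    by move=> /andP[h3 h4]; apply/andP; split; lra.
  have lt1 : a + d n < b - d n by lra.
  have cE1 : {within `[a + d n, b - d n], continuous E}.
    by apply: within_continuous_itv cE; lra.
  have dE1 (x : R) : a + d n < x < b - d n -> is_derive x 1 E (e x).
    by move=> /sub; exact: dE.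
  have ce1 (x : R) : a + d n < x < b - d n -> {for x, continuous e}.
    by move=> /sub; exact: ce.
  rewrite (improper_FTC lt1 ei cE1 dE1 ce1).
  rewrite lee_fin lerB//.
  - apply: (@ge0_derive_le _ E e); first by lra.
    + by apply: within_continuous_itv cE; lra.
    + by move=> x /andP[h3 h4]; apply: dE; apply/andP; split; lra.
    + by move=> x /andP[h3 h4]; apply: e0; apply/andP; split; lra.
  - apply: (@ge0_derive_le _ E e); first by lra.
    + by apply: within_continuous_itv cE; lra.
    + by move=> x /andP[h3 h4]; apply: dE; apply/andP; split; lra.
    + by move=> x /andP[h3 h4]; apply: e0; apply/andP; split; lra.
have cvI : (\int[lebesgue_measure]_(x in F i) (e x)%:E)%E @[i --> \oo] -->
   (\int[lebesgue_measure]_(x in \bigcup_i F i) (e x)%:E)%E.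
  apply: ge0_nondecreasing_set_cvg_integral.
  - move=> m n mn; apply/subsetPset; apply: subset_itvScc; rewrite bnd_simp.
      by rewrite lerD2l hd.
    by rewrite lerD2l lerN2 hd.
  - by move=> i; exact: measurable_itv.
  - move=> i; apply/measurable_EFinP.
    by apply: subspace_continuous_measurable_fun => //; exact: measurable_itv.
  - by move=> i x /Fs /e0; rewrite lee_fin.
have <- := cvg_lim _ cvI => //.
apply: lime_le.
  exact: cvgP cvI.
exact: nearW.
Qed.

Lemma integrable_cat (R : realType) (f : R -> R) (a b c : R) : a <= b -> b <= c ->
  (@lebesgue_measure R).-integrable `[a, b] (EFin \o f) ->
  (@lebesgue_measure R).-integrable `[b, c] (EFin \o f) ->
  (@lebesgue_measure R).-integrable `[a, c] (EFin \o f).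
Proof.
move=> ab bc fab fbc.
have -> : `[a, c]%classic = `[a, b]%classic `|` `]b, c]%classic :> set R.
  by rewrite -itv_bndbnd_setU// ?bnd_simp.
apply: integrable_setU => //.
- apply/disj_set2P; rewrite -subset0 => z/=; rewrite !in_itv/= => -[/andP[_ zb]].
  by rewrite ltNge zb.
- by apply: integrableS fbc => //; apply: subset_itvr; rewrite bnd_simp.
Qed.

Lemma integrable_tile (R : realType) (f : R -> R) (c : nat -> R) (n : nat) :
  (forall i, c i <= c i.+1) ->
  (forall i, (@lebesgue_measure R).-integrable `[c i, c i.+1] (EFin \o f)) ->
  c 0%N <= c n /\ (@lebesgue_measure R).-integrable `[c 0%N, c n] (EFin \o f).
Proof.
move=> cc fi; elim: n => [|n [IHc IHf]].
  split => //; rewrite set_itv1.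
  apply: continuous_compact_integrable.
    exact: compact_set1.
  exact: continuous_subspace1.
split; first exact: le_trans IHc (cc n).
exact: integrable_cat (cc n) IHf (fi n).
Qed.

Lemma Rintegral_tile0 (R : realType) (f : R -> R) (c : nat -> R) (n : nat) :
  (forall i, c i <= c i.+1) ->
  (forall i, (@lebesgue_measure R).-integrable `[c i, c i.+1] (EFin \o f)) ->
  (forall i, \int[lebesgue_measure]_(x in `[c i, c i.+1]) f x = 0) ->
  \int[lebesgue_measure]_(x in `[c 0%N, c n]) f x = 0.
Proof.
move=> cc fi f0; elim: n => [|n IH].
  by rewrite set_itv1 Rintegral_set1.
have [c0n fi0] := integrable_tile n cc fi.
have [c0Sn fi0S] := integrable_tile n.+1 cc fi.
have := @Rintegral_itvB R f (BLeft (c 0%N)) (BRight (c n.+1)) (c n) fi0S.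
rewrite !bnd_simp => /(_ c0n (cc n)); rewrite IH subr0 => ->.
rewrite Rintegral_itv_obnd_cbnd//.
apply: integrableS (fi n) => //.
by apply: subset_itvr; rewrite bnd_simp.
Qed.

(** * Integration by parts against test functions *)

Lemma restrict_supp (R : realType) (f : R -> R) (D : set R) :
  (forall x, ~ D x -> f x = 0) -> f \_ D = f.
Proof.
by move=> fD; apply/funext => x; rewrite patchE; case: ifPn => //; rewrite notin_setE => /fD ->.
Qed.

Lemma integrable_supp (R : realType) (f : R -> R) (D : set R) :
  measurable D -> (forall x, ~ D x -> f x = 0) ->
  (@lebesgue_measure R).-integrable D (EFin \o f) ->
  (@lebesgue_measure R).-integrable setT (EFin \o f).
Proof.
by move=> mD fD /integrable_mkcond -/(_ mD); rewrite restrict_EFin restrict_supp.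
Qed.

Lemma integral_supp (R : realType) (f : R -> R) (D : set R) :
  (forall x, ~ D x -> f x = 0) ->
  (\int[lebesgue_measure]_(x in D) (f x)%:E =
   \int[lebesgue_measure]_x (f x)%:E)%E.
Proof.
move=> fD; rewrite integral_mkcond.
by under eq_integral do rewrite restrict_EFin restrict_supp//.
Qed.

Lemma integral_derive_compact0 (R : realType) (F f : R -> R) (A : R) :
  (forall x : R, is_derive x 1 F (f x)) -> continuous f ->
  (forall x, A < `|x| -> F x = 0) -> (forall x, A < `|x| -> f x = 0) ->
  (\int[lebesgue_measure]_x (f x)%:E = 0)%E.
Proof.
move=> dF cf FA fA; pose B : R := `|A| + 1.
have AB : A < `|B|.
  by rewrite /B ger0_norm ?addr_ge0// (le_lt_trans (ler_norm A))// ltrDl.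
have B0 : 0 < B by rewrite /B ltr_wpDl.
have fB x : ~ (`[- B, B]%classic x) -> f x = 0.
  rewrite /= in_itv/= => /negP; rewrite -ler_norml -ltNge => Bx.
  by apply: fA; apply: lt_trans Bx; rewrite -[B]ger0_norm// ltW.
rewrite -(integral_supp fB) EFin_Rintegral//; last first.
  exact: continuous_integrable_itv.
rewrite (@improper_FTC _ F f)//.
- by rewrite !FA ?subrr// normrN.
- lra.
- exact: continuous_integrable_itv.
- by apply: continuous_subspaceT => x; exact: is_derive_continuous (dF x).
- by move=> x _; exact: cf.
Qed.

(** One closed set and one radius serve all orders of differentiation: [phi] is locally 0 on the
    open complement of its support, so every derivative vanishes there too. *)
Lemma test_functionP (R : realType) (U : set R) (phi : R -> R) :
  test_function U phi ->
  exists2 A : R, 0 < A &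
   [/\ forall n (x : R), is_derive x 1 (derive1n n phi) (derive1n n.+1 phi x),
      forall n, continuous (derive1n n phi),
      forall n x, A < `|x| -> derive1n n phi x = 0 &
      exists2 K, closed K /\ K `<=` U &
         forall n x, ~ K x -> derive1n n phi x = 0].
Proof.
move=> [dphi cK KU].
have der n (x : R) : is_derive x 1 (derive1n n phi) (derive1n n.+1 phi x).
  by apply: is_derive_of_derive1; [exact: dphi|rewrite derive1nS].
set K := closure _ in cK KU.
have offK n x : ~ K x -> derive1n n phi x = 0.
  elim: n x => [|n IH] x Kx.
    rewrite derive1n0; apply/eqP/negPn/negP => h; apply: Kx.
    exact: subset_closure.
  have oK : open (~` K) by apply: closed_openC; exact: closed_closure.
  have nx : \forall y \near x, cst 0 y = derive1n n phi y.
    apply: filterS (open_nbhs_nbhs (conj oK Kx)) => y Ky.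
    by rewrite IH.
  have := near_eq_is_derive nx (is_derive_cst (0 : R) x 1).
  by move=> /@derive_val; have /@derive_val -> := der n x.
have [M [Mr KM]] := compact_bounded cK.
pose A := `|M| + 1.
have MA : M < A by rewrite (le_lt_trans (ler_norm M))// ltrDl.
exists A; first by rewrite /A ltr_wpDl.
split => //.
- by move=> n x; exact: is_derive_continuous (der n x).
- move=> n x Ax; apply: offK => /(KM _ MA).
  by rewrite /= leNgt Ax.
- by exists K => //; split => //; exact: closed_closure.
Qed.

Lemma near_continuous_at (R : realType) (f g : R -> R) (x : R) :
  (\forall y \near x, f y = g y) ->
  {for x, continuous f} -> {for x, continuous g}.
Proof.
move=> fg; rewrite /prop_for /continuous_at -(nbhs_singleton fg).
by apply: cvg_trans; apply: near_eq_cvg; apply: filterS fg => y ->.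
Qed.

Lemma integral_neg_of_add0 (R : realType) (u v : R -> R) :
  (@lebesgue_measure R).-integrable setT (EFin \o u) ->
  (@lebesgue_measure R).-integrable setT (EFin \o v) ->
  (\int[lebesgue_measure]_x (u x + v x)%:E = 0 ->
   \int[lebesgue_measure]_x (u x)%:E = - \int[lebesgue_measure]_x (v x)%:E)%E.
Proof.
move=> ui vi; rewrite integralD_EFin// !EFin_Rintegral// -EFinD -EFinN => -[].
by move=> /eqP; rewrite addr_eq0 => /eqP ->.
Qed.

(** Nothing is known of [a] off [U], but there the product is locally 0, since the complement of [K]
    is open. *)
Lemma continuous_mul_supp (R : realType) (U K : set R) (a psi : R -> R) :
  closed K -> K `<=` U -> (forall x, U x -> {for x, continuous a}) ->
  continuous psi -> (forall x, ~ K x -> psi x = 0) ->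
  continuous (fun x => a x * psi x).
Proof.
move=> cK KU ca cpsi psi0 x.
have [Kx|Kx] := pselect (K x); first by apply: continuousM; [exact: ca (KU _ Kx)|exact: cpsi].
have nx : \forall y \near x, cst (0 : R) y = a y * psi y.
  apply: filterS (open_nbhs_nbhs (conj (closed_openC cK) Kx)) => y Ky.
  by rewrite psi0 ?mulr0.
by apply: near_continuous_at nx _; exact: cst_continuous.
Qed.

Lemma is_derive_mul_supp (R : realType) (U K : set R) (a a1 psi psi1 : R -> R) :
  closed K -> K `<=` U -> (forall x : R, U x -> is_derive x 1 a (a1 x)) ->
  (forall x : R, is_derive x 1 psi (psi1 x)) -> (forall x, ~ K x -> psi x = 0) ->
  (forall x, ~ K x -> psi1 x = 0) ->
  forall x : R, is_derive x 1 (fun x => a x * psi x) (a x * psi1 x + a1 x * psi x).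
Proof.
move=> cK KU da dpsi psi0 psi10 x.
have [Kx|Kx] := pselect (K x).
  have := is_deriveM (da x (KU _ Kx)) (dpsi x).
  by rewrite /GRing.scale/= [psi x * _]mulrC.
rewrite psi0// psi10// !mulr0 addr0.
have nx : \forall y \near x, cst (0 : R) y = a y * psi y.
  apply: filterS (open_nbhs_nbhs (conj (closed_openC cK) Kx)) => y Ky.
  by rewrite psi0 ?mulr0.
by apply: near_eq_is_derive nx _; exact: is_derive_cst.
Qed.

Lemma integrable_continuous_compact0 (R : realType) (f : R -> R) (A : R) :
  continuous f -> (forall x, A < `|x| -> f x = 0) ->
  (@lebesgue_measure R).-integrable setT (EFin \o f).
Proof.
move=> cf fA; apply: (@integrable_supp _ _ `[- A, A]%classic) => //.
  move=> x /=; rewrite in_itv/= => /negP; rewrite -ler_norml -ltNge.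
  exact: fA.
exact: continuous_integrable_itv.
Qed.

(** The product of [a] with a derivative of [phi] is differentiable on the whole line with compact
    support, whatever [a] does off [U], so its derivative has integral 0. The order [k] is free so
    that the lemma can be iterated. *)
Lemma integral_by_parts_test (R : realType) (U : set R) (a a1 phi : R -> R)
    (k : nat) :
  test_function U phi ->
  (forall x : R, U x -> is_derive x 1 a (a1 x)) ->
  (forall x, U x -> {for x, continuous a1}) ->
  (\int[lebesgue_measure]_(x in U) (a x * derive1n k.+1 phi x)%:E =
   - \int[lebesgue_measure]_(x in U) (a1 x * derive1n k phi x)%:E)%E.
Proof.
move=> /test_functionP[A A0 [dphi cphi phiA [K [cK KU] phiK]]] da ca1.
have off k' (b : R -> R) x : ~ U x -> b x * derive1n k' phi x = 0.
  by move=> Ux; rewrite phiK ?mulr0// => /KU.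
rewrite (integral_supp (off _ a)) (integral_supp (off _ a1)).
have ca x : U x -> {for x, continuous a}.
  by move=> /da; exact: is_derive_continuous.
have offA k' (b : R -> R) x : A < `|x| -> b x * derive1n k' phi x = 0.
  by move=> xA; rewrite phiA ?mulr0.
have c1 := continuous_mul_supp cK KU ca (cphi k.+1) (phiK k.+1).
have c2 := continuous_mul_supp cK KU ca1 (cphi k) (phiK k).
apply: integral_neg_of_add0.
- exact: integrable_continuous_compact0 c1 (offA _ _).
- exact: integrable_continuous_compact0 c2 (offA _ _).
have dF := is_derive_mul_supp cK KU da (dphi k) (phiK k) (phiK k.+1).
apply: (integral_derive_compact0 dF _ (offA _ _)).
- by move=> x; exact: (continuousD (c1 x) (c2 x)).
- by move=> x xA; rewrite !offA// addr0.
Qed.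

Lemma continuous_compact_bound (R : realType) (K : set R) (f : R -> R) :
  compact K -> {within K, continuous f} ->
  exists2 M : R, 0 < M & forall x, K x -> `|f x| <= M.
Proof.
move=> cK cf; have [M [_ KM]] := compact_bounded (continuous_compact cf cK).
exists (`|M| + 1); first by rewrite ltr_wpDl.
move=> x Kx; apply: (KM (`|M| + 1)).
  by rewrite (le_lt_trans (ler_norm M))// ltrDl.
by exists x.
Qed.

(* Here a1 may be singular at the end points of the tiles, where a vanishes. *)
Lemma integral_by_parts_test_tile (R : realType) (T : R) (a a1 phi : R -> R) :
  0 < T -> continuous a -> test_function setT phi ->
  (forall j : int, a ((2 * j%:~R - 1) * T) = 0) ->
  (forall j : int, (@lebesgue_measure R).-integrable
     `[(2 * j%:~R - 1) * T, (2 * j%:~R + 1) * T] (EFin \o a1)) ->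
  (forall (j : int) (x : R), (2 * j%:~R - 1) * T < x < (2 * j%:~R + 1) * T ->
     is_derive x 1 a (a1 x) /\ {for x, continuous a1}) ->
  (\int[lebesgue_measure]_x (a x * derive1n 1 phi x)%:E =
   - \int[lebesgue_measure]_x (a1 x * phi x)%:E)%E.
Proof.
move=> T0 ca /test_functionP[A A0 [dphi cphi phiA _]] a0 a1i da.
have d0 (x : R) : is_derive x 1 phi (derive1n 1 phi x) := dphi 0%N x.
have c0 : continuous phi := cphi 0%N.
have c1 := cphi 1%N.
pose N := (Num.Def.truncn (A / T)).+1.
have AN : A < N%:R * T by rewrite -ltr_pdivrMr//; exact: truncnS_gt.
(* Tiles are counted by a natural number i standing for j = i - N. The 2 N + 1 tiles used below
   cover an interval symmetric about 0 which contains the support, because A < N T. *)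
pose c (i : nat) : R := (2 * (i%:Z - N%:Z)%:~R - 1) * T.
have cS i : c i.+1 = (2 * (i%:Z - N%:Z)%:~R + 1) * T.
  by rewrite /c !rmorphB/= -!pmulrn; ring.
have cc i : c i < c i.+1 by rewrite cS /c ltr_pM2r//; lra.
pose u x := a x * derive1n 1 phi x.
pose v x := a1 x * phi x.
have cu : continuous u.
  by move=> x; apply: continuousM; [exact: ca|exact: c1].
have ui i : (@lebesgue_measure R).-integrable `[c i, c i.+1] (EFin \o u).
  exact: continuous_integrable_itv.
have vi i : (@lebesgue_measure R).-integrable `[c i, c i.+1] (EFin \o v).
  have -> : EFin \o v = ((EFin \o a1) \* (EFin \o phi))%E by apply/funext.
  apply: integrableMl => //.
  - by rewrite cS; exact: a1i.
  - by apply: measurable_funTS; exact: continuous_measurable_fun.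
  - have [M _ hM] := continuous_compact_bound (@segment_compact _ (c i) (c i.+1))
      (continuous_subspaceT c0).
    exists M; split; first exact: num_real.
    by move=> y My x /hM /le_trans; apply; exact: ltW.
have uvi i : (@lebesgue_measure R).-integrable `[c i, c i.+1]
    (EFin \o (fun x => u x + v x)).
  have -> : EFin \o (fun x => u x + v x) = ((EFin \o u) \+ (EFin \o v))%E.
    by apply/funext.
  exact: (integrableD _ (ui i) (vi i)).
have dF i (x : R) : c i < x < c i.+1 ->
    is_derive x 1 (fun x => a x * phi x) (u x + v x).
  rewrite cS => /da[dax _]; have := is_deriveM dax (d0 x).
  by rewrite /GRing.scale/= [phi x * _]mulrC.
have cuv i (x : R) : c i < x < c i.+1 -> {for x, continuous (fun x => u x + v x)}.
  rewrite cS => /da[_ ca1]; apply: continuousD; first exact: cu.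
  by apply: continuousM; [exact: ca1|exact: c0].
have cF i : {within `[c i, c i.+1], continuous (fun x => a x * phi x)}.
  apply: continuous_subspaceT => x.
  by apply: continuousM; [exact: ca|exact: c0].
(* Both boundary terms vanish with [a]; this replaces differentiability of [a] across the tile
   ends. *)
have z i : \int[lebesgue_measure]_(x in `[c i, c i.+1]) (u x + v x) = 0.
  rewrite (improper_FTC (cc i) (uvi i) (cF i) (@dF i) (@cuv i)).
  by rewrite !a0 !mul0r subrr.
have ccl i : c i <= c i.+1 by exact: ltW.
pose n := N.*2.+1.
have z0 := Rintegral_tile0 n ccl uvi z.
have [_ vin] := integrable_tile n ccl vi.
have [c0n uvin] := integrable_tile n ccl uvi.
have cN : c 0%N = - c n.
  rewrite /c /n !rmorphB/= -!pmulrn -addn1 -addnn !natrD; ring.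
have An : A < c n.
  apply: lt_le_trans AN _; rewrite /c ler_pM2r// !rmorphB/= -!pmulrn /n.
  by rewrite -addn1 -addnn !natrD; have := ler0n R N; lra.
have off x : ~ `[c 0%N, c n]%classic x -> A < `|x|.
  rewrite /= in_itv/= cN => /negP; rewrite -ler_norml -ltNge.
  exact: lt_trans.
have p0 k x : ~ `[c 0%N, c n]%classic x -> derive1n k phi x = 0.
  by move=> /off; exact: phiA.
have u0 x : ~ `[c 0%N, c n]%classic x -> u x = 0.
  by move=> /(p0 1%N); rewrite /u => ->; rewrite mulr0.
have v0 x : ~ `[c 0%N, c n]%classic x -> v x = 0.
  by move=> /(p0 0%N) h; rewrite /v [phi x]h mulr0.
apply: integral_neg_of_add0.
- apply: integrable_supp u0 _; first exact: measurable_itv.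
  exact: continuous_integrable_itv.
- by apply: integrable_supp v0 _; first exact: measurable_itv.
have uv0 x : ~ `[c 0%N, c n]%classic x -> u x + v x = 0.
  by move=> h; rewrite u0// v0// addr0.
by rewrite -(integral_supp uv0) EFin_Rintegral// z0.
Qed.

Lemma integrable_compact_tile (R : realType) (T : R) (f : R -> R) (K : set R) :
  0 < T ->
  (forall j : int, (@lebesgue_measure R).-integrable
     `[(2 * j%:~R - 1) * T, (2 * j%:~R + 1) * T] (EFin \o f)) ->
  compact K -> (@lebesgue_measure R).-integrable K (EFin \o f).
Proof.
move=> T0 fi cK.
have [A A0 KA] : exists2 A : R, 0 < A & forall x, K x -> `|x| <= A.
  by apply: (@continuous_compact_bound R K id cK); apply: continuous_subspaceT => x; exact: cvg_id.
pose N := (Num.Def.truncn (A / T)).+1.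
have AN : A < N%:R * T by rewrite -ltr_pdivrMr//; exact: truncnS_gt.
pose c (i : nat) : R := (2 * (i%:Z - N%:Z)%:~R - 1) * T.
have cS i : c i.+1 = (2 * (i%:Z - N%:Z)%:~R + 1) * T.
  by rewrite /c !rmorphB/= -!pmulrn; ring.
have cc i : c i <= c i.+1 by rewrite cS /c ler_pM2r//; lra.
have fci i : (@lebesgue_measure R).-integrable `[c i, c i.+1] (EFin \o f).
  by rewrite cS; exact: fi.
have [_] := integrable_tile N.*2.+1 cc fci.
apply: integrableS => //; first exact: compact_measurable.
move=> x /KA; rewrite ler_norml => /andP[x1 x2].
have c0 : c 0%N <= - A.
  by rewrite /c !rmorphB/= -!pmulrn mulr0n; nra.
have cn : A <= c N.*2.+1.
  by rewrite /c !rmorphB/= -!pmulrn -addn1 -addnn !natrD; nra.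
by rewrite /= in_itv/= (le_trans c0)//= (le_trans x2).
Qed.

(** * Local integrability classes *)

Lemma measurable_open_ext (R : realType) (U : set R) (f : R -> R) :
  open U -> (forall x, U x -> {for x, continuous f}) ->
  (forall x, ~ U x -> f x = 0) -> measurable_fun setT f.
Proof.
move=> oU cf f0; rewrite -(restrict_supp f0).
apply/(measurable_restrictT _ (open_measurable oU)).
apply: open_continuous_measurable_fun => // x; rewrite inE.
exact: cf.
Qed.

Lemma Lp_loc_dominated (R : realType) (U : set R) (p : R) (f : R -> R) :
  0 < p -> measurable_fun setT f ->
  (forall K, K `<=` U -> compact K -> exists2 g : R -> R,
     (@lebesgue_measure R).-integrable K (EFin \o g) &
     forall x, K x -> `|f x| `^ p <= g x) ->
  Lp_loc U p f.
Proof.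
move=> p0 mf dom K KU cK; have [g gi fg] := dom K KU cK.
have mK := compact_measurable cK.
have mfK : measurable_fun setT (f \_ K).
  by apply/(measurable_restrictT _ mK); exact: measurable_funTS.
rewrite inE; apply/andP; split; first by rewrite inE.
rewrite inE/= /finite_norm unlock /Lnorm poweR_lty//.
rewrite (_ : (fun x => _) = EFin \o ((fun x => `|f x| `^ p) \_ K)); last first.
  apply/funext => x /=; rewrite !patchE; case: ifPn => // _.
  by rewrite normr0 powR0// gt_eqF.
rewrite -restrict_EFin -integral_mkcond.
have /integrableP[_] := gi; apply: le_lt_trans.
apply: ge0_le_integral => //.
- by move=> x _; rewrite lee_fin powR_ge0.
- apply/measurable_EFinP; apply: (measurableT_comp (measurable_powR p)).
  by apply: measurableT_comp => //; exact: measurable_funTS.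
- by apply: measurableT_comp => //; exact: measurable_int gi.
- by move=> x Kx; rewrite lee_fin (le_trans (fg _ Kx))// ler_norm.
Qed.

Lemma Lp_loc_continuous (R : realType) (U : set R) (p : R) (f : R -> R) :
  0 < p -> measurable_fun setT f -> (forall x, U x -> {for x, continuous f}) ->
  Lp_loc U p f.
Proof.
move=> p0 mf cf; apply: Lp_loc_dominated => // K KU cK.
have cfK : {within K, continuous f}.
  by apply: continuous_in_subspaceT => x; rewrite inE => /KU; exact: cf.
have [M M0 fM] := continuous_compact_bound cK cfK.
exists (cst (M `^ p)).
  apply: continuous_compact_integrable => //.
  by apply: continuous_subspaceT => x; exact: cst_continuous.
by move=> x Kx; rewrite ge0_ler_powR ?nnegrE ?fM// ltW.
Qed.

Lemma locally_integrable_continuous (R : realType) (U : set R) (f : R -> R) :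
  open U -> (forall x, U x -> {for x, continuous f}) -> locally_integrable U f.
Proof.
move=> oU cf; split => //.
  by apply: open_continuous_measurable_fun => // x; rewrite inE; exact: cf.
move=> K KU cK.
have fi : (@lebesgue_measure R).-integrable K (EFin \o f).
  apply: continuous_compact_integrable => //.
  by apply: continuous_in_subspaceT => x; rewrite inE => /KU; exact: cf.
by have /integrableP[] := fi.
Qed.

(** * The change of variable h = cos(t)^2 *)

Definition ell {R : realType} (h : R) : R := ln ((1 + h) / (2 * h)).

(** This is ln (1 + x) <= x at x = (1 - h) / (2 h); the same inequality for the reciprocal gives
    [ell_ge]. Both bounds are sharp to first order at h = 1, which forces the value 2 of [vfun]
    there. *)
Lemma ell_le (R : realType) (h : R) : 0 < h -> ell h <= (1 - h) / (2 * h).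
Proof.
move=> h0; rewrite /ell (_ : (1 + h) / (2 * h) = 1 + (1 - h) / (2 * h)).
  apply: le_ln1Dx; rewrite ltrNl -mulNr ltr_pdivrMr ?mulr_gt0//; lra.
by field; rewrite gt_eqF.
Qed.

Lemma ell_ge (R : realType) (h : R) : 0 < h -> (1 - h) / (1 + h) <= ell h.
Proof.
move=> h0; rewrite /ell -[X in ln X]invrK lnV ?posrE ?invr_gt0 ?divr_gt0 ?mulr_gt0//; last lra.
rewrite (_ : ((1 + h) / (2 * h))^-1 = 1 + - ((1 - h) / (1 + h))); last first.
  by field; rewrite !gt_eqF//; lra.
rewrite lerNr; apply: le_ln1Dx.
by rewrite ltrN2 ltr_pdivrMr//; lra.
Qed.

Lemma ell_gt0 (R : realType) (h : R) : 0 < h < 1 -> 0 < ell h.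
Proof.
by move=> /andP[h0 h1]; apply: lt_le_trans (ell_ge h0); rewrite divr_gt0//; lra.
Qed.

Lemma ell1 (R : realType) : ell (1 : R) = 0.
Proof. by rewrite /ell mulr1 divff// ln1. Qed.

Lemma is_derive_ell (R : realType) (h : R) : 0 < h ->
  is_derive h 1 ell (- (h * (1 + h))^-1).
Proof.
move=> h0.
have p0 : 0 < (1 + h) / (2 * h) by rewrite divr_gt0//; lra.
have n0 : 2 * h != 0 by rewrite gt_eqF//; lra.
have d1 := is_derive_add (is_derive_cst (1 : R) h 1) (is_derive_id h 1).
have d2 := is_derive_scale 2 (is_derive_id h 1).
have := is_derive_comp (is_derive_mul d1 (is_derive_inv n0 d2)) (is_derive1_ln p0).
move/is_derive_eq; apply; rewrite /cst/=.
by field; rewrite !gt_eqF//; lra.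
Qed.

(** The continuous extension of (1 - h) / ell(h): the logarithm sends it to 0 at h = 0, and the
    common first-order zero at h = 1 leaves the limit 2. Constant values outside [0, 1] give
    continuity on the whole line. *)
Definition vfun {R : realType} (h : R) : R :=
  if h <= 0 then 0 else if 1 <= h then 2 else (1 - h) / ell h.

Lemma vfunE (R : realType) (h : R) : 0 < h < 1 -> vfun h = (1 - h) / ell h.
Proof. by move=> /andP[h0 h1]; rewrite /vfun leNgt h0 leNgt h1. Qed.

Lemma vfun_ge (R : realType) (h : R) : h <= 1 -> 2 * h <= vfun h.
Proof.
move=> h1; rewrite /vfun; have [h0|h0] := leP h 0; first lra.
have [h2|h2] := leP 1 h; first lra.
have e0 : 0 < ell h by rewrite ell_gt0// h0.
rewrite ler_pdivlMr//; have := ell_le h0.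
by rewrite ler_pdivlMr ?mulr_gt0// => /le_trans; rewrite mulrC => ->.
Qed.

Lemma vfun_le (R : realType) (h : R) : 0 <= h -> vfun h <= 1 + h.
Proof.
move=> h1; rewrite /vfun; have [h0|h0] := leP h 0; first lra.
have [h2|h2] := leP 1 h; first lra.
have e0 : 0 < ell h by rewrite ell_gt0// h0.
rewrite ler_pdivrMr//; have := ell_ge h0.
by rewrite ler_pdivrMr 1?mulrC//; lra.
Qed.

Lemma vfun_le2 (R : realType) (h : R) : vfun h <= 2.
Proof.
have [h0|h0] := leP h 0; first by rewrite /vfun h0.
have [h1|h1] := leP 1 h; first by rewrite /vfun (lt_geF h0) h1.
by apply: le_trans (vfun_le (ltW h0)) _; lra.
Qed.

Lemma vfun_gt0 (R : realType) (h : R) : 0 < h -> 0 < vfun h.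
Proof.
move=> h0; have [h1|h1] := leP 1 h; first by rewrite /vfun (lt_geF h0) h1.
by apply: lt_le_trans (vfun_ge (ltW h1)); rewrite mulr_gt0.
Qed.

Lemma vfun_ge0 (R : realType) (h : R) : 0 <= vfun h.
Proof.
have [h0|h0] := leP h 0; first by rewrite /vfun h0.
exact/ltW/vfun_gt0.
Qed.

(** The threshold comes from [ell h] >= ln (1 / (2 h)), which is at least 1 / e once 2 h <= exp (- 1
    / e); the numerator 1 - h is at most 1. *)
Lemma vfun_small (R : realType) (e h : R) : 0 < e -> h < expR (- e^-1) / 2 ->
  vfun h <= e.
Proof.
move=> e0 he; have [h0|h0] := leP h 0; first by rewrite /vfun h0 ltW.
have E1 : expR (- e^-1) < 1 by rewrite expR_lt1 oppr_lt0 invr_gt0.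
have h1 : h < 1 by lra.
have h01 : 0 < h < 1 by rewrite h0.
rewrite vfunE// ler_pdivrMr ?ell_gt0//.
have : e^-1 <= ell h.
  rewrite -[e^-1]expRK ler_ln ?posrE ?expR_gt0 ?divr_gt0 ?mulr_gt0//; last lra.
  rewrite ler_pdivlMr ?mulr_gt0// mulrA.
  rewrite expRN ltr_pdivlMr// in he.
  move: he; rewrite -(ltr_pM2l (expR_gt0 e^-1)) mulfV ?gt_eqF ?expR_gt0//; nra.
by rewrite -(ler_pM2l e0) mulfV ?gt_eqF//; lra.
Qed.

Lemma continuous_vfun (R : realType) : continuous (@vfun R).
Proof.
move=> h; have [h0|h0|->] := ltgtP h 0.
- have nx : \forall y \near h, cst 0 y = vfun y.
    by near=> y; rewrite /vfun ltW//; near: y; exact: lt_nbhsl.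
  by apply: near_continuous_at nx _; exact: cst_continuous.
- have [h1|h1|->] := ltgtP h 1.
  + have nx : \forall y \near h, (1 - y) / ell y = vfun y.
      near=> y; rewrite vfunE//; apply/andP; split.
        by near: y; exact: lt_nbhsr.
      by near: y; exact: lt_nbhsl.
    apply: near_continuous_at nx _.
    apply: continuousM.
      by apply: continuousB => //; exact: cst_continuous.
    apply: continuousV; first by rewrite gt_eqF// ell_gt0// h0.
    apply: is_derive_continuous; exact: is_derive_ell.
  + have nx : \forall y \near h, cst 2 y = vfun y.
      near=> y; rewrite /vfun leNgt (_ : 0 < y)/=; last first.
        by near: y; exact: lt_nbhsr.
      by rewrite ltW//; near: y; exact: lt_nbhsr.
    by apply: near_continuous_at nx _; exact: cst_continuous.
  + apply/cvgrPdist_le => e e0; near=> y.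
    have y0 : 0 < y by near: y; exact: lt_nbhsr.
    rewrite {1}/vfun (lt_geF ltr01) lexx.
    have [y1|y1] := leP 1 y.
      by rewrite /vfun (lt_geF y0) y1 subrr normr0 ltW.
    have h3 := vfun_ge (ltW y1).
    have h4 := vfun_le (ltW y0).
    have h5 : 1 - e / 2 < y by near: y; apply: lt_nbhsr; lra.
    by rewrite ger0_norm; lra.
- apply/cvgrPdist_le => e e0; near=> y.
  rewrite {1}/vfun lexx sub0r normrN ger0_norm ?vfun_ge0//.
  apply: vfun_small => //; near: y; apply: lt_nbhsl.
  by rewrite divr_gt0// expR_gt0.
Unshelve. all: by end_near. Qed.

(* [wfun g M t] is dx/dt along the solution x = X(t), where h(X(t)) = cos(t)^2. *)
Definition wfun {R : realType} (g M t : R) : R :=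
  Num.sqrt (2 * vfun (cos t ^+ 2) / (M - g * vfun (cos t ^+ 2) / 2)).

(** The slope h' as a function of t: the derivative of cos(t)^2 divided by dx/dt. Where cos t = 0
    the convention 0^-1 = 0 returns 0, which is the right slope. *)
Definition etafun {R : realType} (g M t : R) : R :=
  - (2 * sin t * cos t) / wfun g M t.

Lemma cos2_01 (R : realType) (t : R) : 0 <= cos t ^+ 2 <= 1.
Proof. by rewrite sqr_ge0 cos2sin2 lerBlDr lerDl sqr_ge0. Qed.

Lemma den_ge (R : realType) (g M t : R) : 0 < g ->
  M - g <= M - g * vfun (cos t ^+ 2) / 2.
Proof. by move=> g0; have := vfun_le2 (cos t ^+ 2); nra. Qed.

Lemma den_gt0 (R : realType) (g M t : R) : 0 < g -> g < M ->
  0 < M - g * vfun (cos t ^+ 2) / 2.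
Proof. by move=> g0 gM; apply: lt_le_trans (den_ge M t g0); lra. Qed.

Lemma wfun2 (R : realType) (g M t : R) : 0 < g -> g < M ->
  wfun g M t ^+ 2 = 2 * vfun (cos t ^+ 2) / (M - g * vfun (cos t ^+ 2) / 2).
Proof.
move=> g0 gM; rewrite sqr_sqrtr// divr_ge0 ?mulr_ge0 ?vfun_ge0//.
exact/ltW/den_gt0.
Qed.

Lemma continuous_vcos (R : realType) : continuous (fun t : R => vfun (cos t ^+ 2)).
Proof.
move=> t; apply: (@continuous_at_comp R vfun (fun t => cos t ^+ 2) t).
  apply: (@continuous_at_comp R (fun x => x ^+ 2) cos t).
    exact: continuous_cos.
  exact: exprn_continuous.
exact: continuous_vfun.
Qed.

Lemma continuous_wfun (R : realType) (g M : R) : 0 < g -> g < M ->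
  continuous (wfun g M).
Proof.
move=> g0 gM t; apply: (@continuous_at_comp R Num.sqrt
  (fun t => 2 * vfun (cos t ^+ 2) / (M - g * vfun (cos t ^+ 2) / 2)) t);
  last exact: sqrt_continuous.
have cv := @continuous_vcos R t.
apply: continuousM.
  by apply: continuousM => //; exact: cst_continuous.
apply: continuousV; first by rewrite gt_eqF// den_gt0.
apply: continuousB; first exact: cst_continuous.
apply: continuousM; last exact: cst_continuous.
by apply: continuousM => //; exact: cst_continuous.
Qed.

Lemma wfun_gt0 (R : realType) (g M t : R) : 0 < g -> g < M -> cos t != 0 ->
  0 < wfun g M t.
Proof.
move=> g0 gM ct; rewrite sqrtr_gt0 divr_gt0 ?den_gt0// mulr_gt0// vfun_gt0//.
by rewrite exprn_even_gt0.
Qed.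

Lemma wfun_ge0 (R : realType) (g M t : R) : 0 <= wfun g M t.
Proof. exact: sqrtr_ge0. Qed.

Lemma wfun_le (R : realType) (g M t : R) : 0 < g -> g < M ->
  wfun g M t <= 2 / Num.sqrt (M - g).
Proof.
move=> g0 gM; have Mg : 0 < M - g by rewrite subr_gt0.
rewrite -(@ler_pXn2r _ 2)// ?nnegrE ?wfun_ge0 ?divr_ge0 ?sqrtr_ge0//.
rewrite wfun2// expr_div_n sqr_sqrtr ?(ltW Mg)//.
have d1 := den_ge M t g0; have d0 := den_gt0 t g0 gM.
rewrite ler_pdivrMr// mulrAC ler_pdivlMr//.
have := vfun_le2 (cos t ^+ 2); have := vfun_ge0 (cos t ^+ 2); nra.
Qed.

(* The right-hand side has the primitive [2 / sqrt g * ln (r + sqrt g * sin t)]. *)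
Lemma wfun_ge (R : realType) (g r t : R) : 0 < g -> 0 < r -> 0 <= cos t -> 0 <= sin t ->
  2 * cos t / (r + Num.sqrt g * sin t) <= wfun g (g + r ^+ 2) t.
Proof.
move=> g0 r0 c0 s0.
have gM : g < g + r ^+ 2 by rewrite ltrDl exprn_gt0.
have k0 : 0 <= Num.sqrt g := sqrtr_ge0 g.
have D0 : 0 < r + Num.sqrt g * sin t by rewrite ltr_wpDr// mulr_ge0.
rewrite -(@ler_pXn2r _ 2)// ?nnegrE ?wfun_ge0 ?divr_ge0 ?mulr_ge0 ?(ltW D0)//.
rewrite wfun2// expr_div_n.
have d0 := den_gt0 t g0 gM.
rewrite ler_pdivlMr// mulrAC ler_pdivrMr ?exprn_gt0//.
have /andP[c20 c21] := cos2_01 t.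
have v1 := vfun_ge c21.
(* By [vfun_ge] the left side is at most r^2 + g sin(t)^2; adding the nonnegative cross term
   completes the square and removes the root, which is what makes the primitive elementary. *)
have E1 : g + r ^+ 2 - g * vfun (cos t ^+ 2) / 2 <= (r + Num.sqrt g * sin t) ^+ 2.
  have -> : (r + Num.sqrt g * sin t) ^+ 2 =
      r ^+ 2 + 2 * (r * (Num.sqrt g * sin t)) + g * (1 - cos t ^+ 2).
    by rewrite -sin2cos2 -[in g * _](sqr_sqrtr (ltW g0)); ring.
  have : 0 <= r * (Num.sqrt g * sin t) by rewrite !mulr_ge0// ltW.
  nra.
rewrite exprMn.
apply: ler_pM => //; first by rewrite mulr_ge0// sqr_ge0.
  exact: ltW.
by rewrite [2 ^+ 2]expr2; lra.
Qed.

(** * The half period as a function of M *)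

Definition halfperiod {R : realType} (g M : R) : R :=
  \int[lebesgue_measure]_(t in `[0, pi / 2]) wfun g M t.

Lemma halfperiodE (R : realType) (g M : R) (X : R -> R) : 0 < g -> g < M ->
  (forall t : R, is_derive t 1 X (wfun g M t)) ->
  halfperiod g M = X (pi / 2) - X 0.
Proof.
move=> g0 gM dX; apply: improper_FTC.
- by rewrite divr_gt0// pi_gt0.
- exact/continuous_integrable_itv/continuous_wfun.
- by apply: continuous_subspaceT => x; exact: is_derive_continuous (dX x).
- by move=> x _; exact: continuous_wfun.
Qed.

Lemma halfperiod_le (R : realType) (g M : R) : 0 < g -> g < M ->
  halfperiod g M <= pi / Num.sqrt (M - g).
Proof.
move=> g0 gM; have [X dX] := exists_primitive (continuous_wfun g0 gM).
rewrite (halfperiodE g0 gM dX).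
pose k := 2 / Num.sqrt (M - g).
have dY (t : R) : is_derive t 1 (fun t => k * t - X t) (k * 1 - wfun g M t).
  exact: is_derive_sub (is_derive_scale k (is_derive_id t 1)) (dX t).
have := @ge0_derive_le R (fun t => k * t - X t) _ 0 (pi / 2) _ _ (fun x _ => dY x).
have p0 : 0 <= pi / 2 :> R by rewrite divr_ge0// pi_ge0.
move=> /(_ p0) H.
have : k * 0 - X 0 <= k * (pi / 2) - X (pi / 2).
  apply: H => [|x _].
    by apply: continuous_subspaceT => x; exact: is_derive_continuous (dY x).
  by rewrite mulr1 subr_ge0 wfun_le.
have -> : k * (pi / 2) = pi / Num.sqrt (M - g).
  by rewrite /k; field; rewrite gt_eqF// sqrtr_gt0 subr_gt0.
lra.
Qed.

(** The integrated form of [wfun_ge]. Writing M = g + r^2 exhibits the logarithmic blow-up as r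
    tends to 0. *)
Lemma halfperiod_ge (R : realType) (g r : R) : 0 < g -> 0 < r ->
  2 / Num.sqrt g * ln (Num.sqrt g / r) <= halfperiod g (g + r ^+ 2).
Proof.
move=> g0 r0; have gM : g < g + r ^+ 2 by rewrite ltrDl exprn_gt0.
have [X dX] := exists_primitive (continuous_wfun g0 gM).
rewrite (halfperiodE g0 gM dX).
set q := Num.sqrt g; have q0 : 0 < q by rewrite sqrtr_gt0.
have p0 : 0 <= pi / 2 :> R by rewrite divr_ge0// pi_ge0.
pose F (t : R) := X t - 2 / q * ln (r + q * sin t).
have dF (t : R) : 0 <= sin t ->
    is_derive t 1 F (wfun g (g + r ^+ 2) t - 2 * cos t / (r + q * sin t)).
  move=> st; have D0 : 0 < r + q * sin t by rewrite ltr_wpDr// mulr_ge0// ltW.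
  have d1 := is_derive_add (is_derive_cst r t 1) (is_derive_scale q (is_derive_sin t)).
  have d2 := is_derive_scale (2 / q) (is_derive_comp d1 (is_derive1_ln D0)).
  have := is_derive_sub (dX t) d2.
  move/is_derive_eq; apply; congr (_ - _).
  by rewrite add0r; field; rewrite !gt_eqF.
have s0 (t : R) : 0 <= t <= pi / 2 -> 0 <= sin t.
  move=> /andP[t0 t1]; apply: sin_ge0_pi; rewrite t0/=.
  have := @pi_gt0 R; lra.
have cF : {within `[0, pi / 2], continuous F}.
  apply: continuous_in_subspaceT => t; rewrite inE/= in_itv/= => /s0 st.
  exact: is_derive_continuous (dF t st).
have dF' (t : R) : 0 < t < pi / 2 ->
    is_derive t 1 F (wfun g (g + r ^+ 2) t - 2 * cos t / (r + q * sin t)).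
  by move=> /andP[t0 t1]; apply: dF; apply: s0; rewrite !ltW.
have := ge0_derive_le p0 cF dF' => /(_ _).
rewrite /F sin0 sin_pihalf mulr0 addr0 mulr1 => H.
have : X 0 - 2 / q * ln r <= X (pi / 2) - 2 / q * ln (r + q).
  apply: H => t /andP[t0 t1]; rewrite subr_ge0; apply: wfun_ge => //.
    by apply: cos_ge0_pihalf; rewrite (ltW t1) andbT; lra.
  by apply: s0; rewrite !ltW.
rewrite ln_div ?posrE//.
have : ln q <= ln (r + q) by rewrite ler_ln ?posrE ?addr_gt0// lerDr ltW.
have : 0 < 2 / q by rewrite divr_gt0.
nra.
Qed.

Lemma continuous_wfun_parameter (R : realType) (g M t : R) : 0 < g -> g < M ->
  {for M, continuous (fun M => wfun g M t)}.
Proof.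
move=> g0 gM; apply: (@continuous_at_comp R Num.sqrt
  (fun M => 2 * vfun (cos t ^+ 2) / (M - g * vfun (cos t ^+ 2) / 2)) M);
  last exact: sqrt_continuous.
apply: continuousM; first exact: cst_continuous.
apply: continuousV; first by rewrite gt_eqF// den_gt0.
by apply: continuousB => //; exact: cst_continuous.
Qed.

(** Dominated convergence in the parameter. The bound of [wfun_le] degenerates at g, so the
    neighbourhood of M starts at the midpoint [M1], where that bound is a constant valid for all
    larger parameters. *)
Lemma continuous_halfperiod (R : realType) (g M : R) : 0 < g -> g < M ->
  {for M, continuous (halfperiod g)}.
Proof.
move=> g0 gM; pose M1 := (g + M) / 2.
have gM1 : g < M1 by rewrite /M1; lra.
have M1M : M1 < M by rewrite /M1; lra.
have I0 (N : R) : `]M1, (M + 1)[%classic N -> g < N.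
  by rewrite /= in_itv/= => /andP[/(lt_trans gM1)].
have := @continuity_under_integral R _ _ (@lebesgue_measure R) (wfun g)
  `[0, pi / 2]%classic (measurable_itv _) M1 (M + 1) _ _
  (cst (2 / Num.sqrt (M1 - g))) _ _.
apply.
- by move=> N /I0 gN; exact/continuous_integrable_itv/continuous_wfun.
- apply: aeW => t _ N /set_mem /I0 gN; exact: continuous_wfun_parameter.
- by apply: continuous_integrable_itv => x; exact: cst_continuous.
- move=> N /[dup] /I0 gN; rewrite /= in_itv/= => /andP[M1N _].
  apply: aeW => t _; rewrite ger0_norm ?wfun_ge0//.
  apply: le_trans (wfun_le t g0 gN) _.
  rewrite ler_pM2l// lef_pV2 ?posrE ?sqrtr_gt0 ?subr_gt0// ler_wsqrtr//; lra.
- by apply/mem_set; rewrite /= in_itv/= M1M ltrDl ltr01.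
Qed.

Lemma exists_halfperiod (R : realType) (g T : R) : 0 < g -> 0 < T ->
  exists2 M : R, g < M & halfperiod g M = T.
Proof.
move=> g0 T0.
(* This [r] makes the lower bound of [halfperiod_ge] exactly T. *)
pose r := Num.sqrt g * expR (- (Num.sqrt g * T / 2)).
have q0 : 0 < Num.sqrt g by rewrite sqrtr_gt0.
have r0 : 0 < r by rewrite mulr_gt0// expR_gt0.
pose Ma := g + r ^+ 2.
have gMa : g < Ma by rewrite ltrDl exprn_gt0.
have Ta : T <= halfperiod g Ma.
  apply: le_trans (halfperiod_ge g0 r0).
  rewrite /r invfM mulrA mulfV ?gt_eqF// mul1r -expRN opprK expRK.
  by rewrite le_eqVlt; apply/orP; left; apply/eqP; field; rewrite gt_eqF.
(* Then Mb - g >= (pi / T)^2, so the upper bound pi / sqrt (Mb - g) is at most T. *)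
pose Mb := Ma + (pi / T) ^+ 2.
have Mab : Ma <= Mb by rewrite lerDl sqr_ge0.
have gMb : g < Mb by exact: lt_le_trans Mab.
have Tb : halfperiod g Mb <= T.
  apply: le_trans (halfperiod_le g0 gMb) _.
  rewrite ler_pdivrMr ?sqrtr_gt0 ?subr_gt0// -ler_pdivrMl// mulrC.
  rewrite -[X in X <= _]ger0_norm ?divr_ge0 ?pi_ge0 ?(ltW T0)// -sqrtr_sqr.
  by rewrite ler_wsqrtr// /Mb /Ma; have := sqr_ge0 r; lra.
have vT : Num.min (halfperiod g Ma) (halfperiod g Mb) <= T <=
          Num.max (halfperiod g Ma) (halfperiod g Mb).
  by rewrite ge_min Tb orbT le_max Ta.
have [|M] := IVT Mab _ vT.
  apply: continuous_in_subspaceT => M; rewrite inE/= in_itv/= => /andP[M1 M2].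
  by apply: continuous_halfperiod => //; exact: lt_le_trans M1.
by rewrite in_itv/= => /andP[/(lt_le_trans gMa) gM _] <-; exists M.
Qed.

(** * The slope as a function of the angle *)

Lemma etafun_mul (R : realType) (g M t : R) : 0 < g -> g < M ->
  etafun g M t * wfun g M t = - (2 * sin t * cos t).
Proof.
move=> g0 gM; rewrite /etafun; have [ct|ct] := eqVneq (cos t) 0.
  by rewrite ct mulr0 oppr0 !mul0r.
by rewrite mulfVK// gt_eqF// wfun_gt0.
Qed.

(** The energy identity read in t. For 0 < h < 1 the factor sin(t)^2 = 1 - h equals
    [vfun h * ell h], which cancels the numerator of [wfun] squared; at h = 1 both sides are 0. *)
Lemma etafun_sqr (R : realType) (g M t : R) : 0 < g -> g < M -> cos t != 0 ->
  etafun g M t ^+ 2 = 2 * cos t ^+ 2 *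
    (M * ell (cos t ^+ 2) - g * (1 - cos t ^+ 2) / 2).
Proof.
move=> g0 gM ct; set h := cos t ^+ 2.
have h0 : 0 < h by rewrite exprn_even_gt0.
have /andP[_ h1] := cos2_01 t.
have v0 := vfun_gt0 h0; have d0 := den_gt0 t g0 gM.
rewrite /etafun expr_div_n wfun2// sqrrN !exprMn sin2cos2 -/h.
have [h1'|h1'] := eqVneq h 1.
  by rewrite h1' subrr ell1 !(mulr0,mul0r) subrr mulr0.
have h01 : 0 < h < 1 by rewrite h0 lt_neqAle h1'.
have e0 := ell_gt0 h01.
rewrite -/h in d0.
have Ev : vfun h * ell h = 1 - h by rewrite vfunE// divfK// gt_eqF.
rewrite invf_div -Ev; field.
by rewrite !gt_eqF//; lra.
Qed.

(** With c = |cos t|, the inequality ln (1 / c) < 1 / c gives c^2 ell(c^2) <= 2 c. This bound yields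
    continuity of the slope at the zeros of cos, where [etafun] divides by 0. *)
Lemma etafun_sqr_le (R : realType) (g M t : R) : 0 < g -> g < M ->
  etafun g M t ^+ 2 <= 4 * M * `|cos t|.
Proof.
move=> g0 gM; have [ct|ct] := eqVneq (cos t) 0.
  by rewrite /etafun ct normr0 !mulr0 oppr0 mul0r expr0n.
have /andP[_ h1] := cos2_01 t.
have c0 : 0 < `|cos t| by rewrite normr_gt0.
rewrite etafun_sqr// -[cos t ^+ 2]real_normK ?num_real//.
rewrite -[cos t ^+ 2]real_normK ?num_real// in h1.
set c := `|cos t| in c0 h1 *.
have E : ell (c ^+ 2) <= 2 / c.
  have -> : ell (c ^+ 2) = ln ((1 + c ^+ 2) / 2) + 2 * ln c^-1.
    rewrite mulr_natl -lnXn ?posrE ?invr_gt0// -lnM ?posrE; last 2 first.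
    - rewrite divr_gt0//; have := sqr_ge0 c; lra.
    - by rewrite exprn_gt0// invr_gt0.
    by rewrite /ell; congr ln; field; rewrite gt_eqF.
  have H1 : ln ((1 + c ^+ 2) / 2) <= 0.
    apply: ln_le0; lra.
  have H2 : ln c^-1 < c^-1 by apply: ln_sublinear; rewrite invr_gt0.
  lra.
have M0 : 0 < M by lra.
have c2 : 0 <= c ^+ 2 by rewrite sqr_ge0.
have E2 : c ^+ 2 * ell (c ^+ 2) <= 2 * c.
  have -> : 2 * c = c ^+ 2 * (2 / c) by field; rewrite gt_eqF.
  by rewrite ler_wpM2l.
have : 0 <= c ^+ 2 * (g * (1 - c ^+ 2) / 2).
  by rewrite !mulr_ge0//; lra.
have : M * (c ^+ 2 * ell (c ^+ 2)) <= M * (2 * c) by rewrite ler_wpM2l// ltW.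
lra.
Qed.

Lemma continuous_etafun (R : realType) (g M : R) : 0 < g -> g < M ->
  continuous (etafun g M).
Proof.
move=> g0 gM t; have [ct|ct] := eqVneq (cos t) 0; last first.
  suff : {for t, continuous (fun t => - (2 * sin t * cos t) * (wfun g M t)^-1)} by [].
  apply: continuousM; last first.
    apply: continuousV; first by rewrite gt_eqF// wfun_gt0.
    exact: continuous_wfun.
  apply: continuousN; apply: continuousM; last exact: continuous_cos.
  by apply: continuousM; [exact: cst_continuous|exact: continuous_sin].
have e0 : etafun g M t = 0 by rewrite /etafun ct mulr0 oppr0 mul0r.
apply/cvgrPdist_le => e e_gt0; rewrite e0; near=> y.
rewrite sub0r normrN -(@ler_pXn2r _ 2)// ?nnegrE ?(ltW e_gt0)//.
rewrite real_normK ?num_real//; apply: le_trans (etafun_sqr_le y g0 gM) _.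
have M0 : 0 < 4 * M by lra.
rewrite -ler_pdivlMl// mulrC; apply/ltW.
near: y.
have : cos y @[y --> t] --> cos t by exact: continuous_cos.
move/cvgrPdist_lt => /(_ (e ^+ 2 / (4 * M))) H.
have /H : 0 < e ^+ 2 / (4 * M) by rewrite divr_gt0 ?exprn_gt0//; lra.
by apply: filterS => y; rewrite ct sub0r normrN.
Unshelve. all: by end_near. Qed.

(** * The map X and its inverse *)

Lemma wfunN (R : realType) (g M t : R) : wfun g M (- t) = wfun g M t.
Proof. by rewrite /wfun cosN. Qed.

Lemma wfunDpi (R : realType) (g M t : R) : wfun g M (t + pi) = wfun g M t.
Proof. by rewrite /wfun cosDpi sqrrN. Qed.

Lemma cos_neq0_dense (R : realType) (a b : R) : a < b ->
  exists2 t, a < t < b & cos t != 0.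
Proof.
move=> ab; apply/not_exists2P => H.
have c0 t : a < t < b -> cos t = 0.
  by move=> tab; have [//|/negP/negPn/eqP] := H t.
pose m := (a + b) / 2.
have am : a < m by rewrite /m; lra.
have mb : m < b by rewrite /m; lra.
have nx : \forall y \near m, cst 0 y = cos y.
  have : \forall y \near m, y \in `]a, b[ by apply: near_in_itvoo; rewrite in_itv/= am.
  by apply: filterS => y; rewrite in_itv/= => /c0 ->.
have := near_eq_is_derive nx (is_derive_cst (0 : R) m 1).
move=> /@derive_val; have /@derive_val -> := is_derive_cos m.
move=> /eqP; rewrite oppr_eq0 => /eqP s0.
have := cos2Dsin2 m; rewrite s0 c0 ?am// expr0n/= addr0 => /eqP.
by rewrite eq_sym oner_eq0.
Qed.

(** As X' vanishes where cos does, strictness needs an argument: X a = X b would make X constant on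
    [a, b], against X' > 0 at some point of that interval. *)
Lemma primitive_wfun_lt (R : realType) (g M : R) (X : R -> R) :
  0 < g -> g < M -> (forall t : R, is_derive t 1 X (wfun g M t)) ->
  {mono X : a b / a < b}.
Proof.
move=> g0 gM dX.
have Xle a b : a <= b -> X a <= X b.
  move=> ab; apply: (ge0_derive_le ab _ (fun t _ => dX t)) => [|t _].
    by apply: continuous_subspaceT => t; exact: is_derive_continuous (dX t).
  exact: wfun_ge0.
apply: leW_mono; apply: le_mono => a b ab; rewrite lt_neqAle Xle 1?ltW// andbT.
apply/eqP => Xab; have [t /andP[at' tb] ct] := cos_neq0_dense ab.
have nx : \forall y \near t, cst (X a) y = X y.
  have : \forall y \near t, y \in `]a, b[ by apply: near_in_itvoo; rewrite in_itv/= at'.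
  apply: filterS => y; rewrite in_itv/= => /andP[ay yb].
  by apply/eqP; rewrite eq_le Xle ?(ltW ay)//= Xab Xle// ltW.
have := near_eq_is_derive nx (is_derive_cst (X a) t 1).
move=> /@derive_val; have /@derive_val -> := dX t.
by apply/eqP; rewrite gt_eqF// wfun_gt0.
Qed.

(** Only continuity is asked of [theta], the inverse of X: it has infinite slope wherever X' = 0,
    that is at the zeros of the film. *)
Definition is_time {R : realType} (g M : R) (X theta : R -> R) : Prop :=
  [/\ forall t : R, is_derive t 1 X (wfun g M t),
        cancel X theta, cancel theta X, {mono X : a b / a < b} &
        [/\ continuous theta, forall t, X (- t) = - X t,
            forall t, X (t + pi) = X t + 2 * halfperiod g M &
            X (pi / 2) = halfperiod g M]].

(** X inherits the symmetries of [wfun] because two primitives of one function differ by a constant,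
    evaluated at 0 for oddness and at - pi / 2 for the translation law. The latter makes X unbounded
    in both directions, hence onto; strict monotonicity then makes the inverse continuous. *)
Lemma exists_time (R : realType) (g M : R) : 0 < g -> g < M ->
  exists X theta : R -> R, is_time g M X theta.
Proof.
move=> g0 gM; have [Y dY] := exists_primitive (continuous_wfun g0 gM).
pose X t := Y t - Y 0.
have dX (t : R) : is_derive t 1 X (wfun g M t).
  have := is_derive_sub (dY t) (is_derive_cst (Y 0) t 1).
  by rewrite subr0.
have X0 : X 0 = 0 by rewrite /X subrr.
have XT : X (pi / 2) = halfperiod g M.
  by rewrite (halfperiodE g0 gM dX) X0 subr0.
have Xlt := primitive_wfun_lt g0 gM dX.
have XN t : X (- t) = - X t.
  have dXN (s : R) : is_derive s 1 (fun s => - X (- s)) (wfun g M s).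
    have d1 := is_derive_comp (is_deriveN (is_derive_id s 1)) (dX (- s)).
    have := is_deriveN d1.
    by rewrite mulrN1 opprK wfunN.
  have := primitive_unique t 0 dXN dX.
  by rewrite oppr0 X0; lra.
have XD t : X (t + pi) = X t + 2 * halfperiod g M.
  have dXD (s : R) : is_derive s 1 (fun s => X (s + pi)) (wfun g M s).
    have ds := is_derive_add (is_derive_id s 1) (is_derive_cst (pi : R) s 1).
    have := is_derive_comp ds (dX (s + pi)).
    by rewrite wfunDpi addr0 mulr1.
  have := primitive_unique t (- (pi / 2)) dXD dX.
  have -> : - (pi / 2) + pi = pi / 2 :> R by field.
  by rewrite XN XT; lra.
have T0 : 0 < halfperiod g M.
  by rewrite -XT -X0 Xlt divr_gt0// pi_gt0.
have cX : continuous X by move=> t; exact: is_derive_continuous (dX t).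
have Xn (n : nat) : X (n%:R * pi) = n%:R * (2 * halfperiod g M).
  elim: n => [|n IH]; first by rewrite !mul0r.
  have -> : n.+1%:R * pi = n%:R * pi + pi :> R by ring.
  by rewrite XD IH; ring.
have Xsurj y : exists t, X t = y.
  have [n ny] : exists n : nat, `|y| / (2 * halfperiod g M) < n%:R.
    by exists (Num.Def.truncn (`|y| / (2 * halfperiod g M))).+1; exact: truncnS_gt.
  have yn : `|y| <= X (n%:R * pi) by rewrite Xn -ler_pdivrMr ?mulr_gt0// ltW.
  move: yn; rewrite ler_norml -XN => /andP[y1 y2].
  have n0 : - (n%:R * pi) <= n%:R * pi :> R.
    have : 0 <= n%:R * pi :> R by rewrite mulr_ge0// pi_ge0.
    lra.
  have [|t _ <-] := @IVT R X _ _ y n0 (continuous_subspaceT cX); last by exists t.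
  by rewrite ge_min y1/= le_max y2 orbT.
have [theta thetaK] := choice Xsurj.
have Xinj : injective X.
  move=> a b ab; have [aLb|bLa|//] := ltgtP a b.
    by have := ltxx (X b); rewrite -{1}ab Xlt aLb.
  by have := ltxx (X a); rewrite {1}ab Xlt bLa.
have XK : cancel X theta by move=> t; apply: Xinj; rewrite thetaK.
exists X, theta; split => //; split => //.
move=> y; apply/cvgrPdist_lt => e e0.
have ty1 : X (theta y - e) < y by rewrite -{2}(thetaK y) Xlt ltrBlDr ltrDl.
have ty2 : y < X (theta y + e) by rewrite -{1}(thetaK y) Xlt ltrDl.
have : \forall z \near y, z \in `]X (theta y - e), X (theta y + e)[.
  by apply: near_in_itvoo; rewrite in_itv/= ty1.
apply: filterS => z; rewrite in_itv/= -{1 2}(thetaK z) !Xlt => /andP[h1 h2].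
by rewrite ltr_norml; apply/andP; split; lra.
Qed.

(** * The film profile *)

Lemma additive_int (R : realType) (F : R -> R) (p q : R) :
  (forall t, F (t + p) = F t + q) ->
  forall (j : int) (t : R), F (t + j%:~R * p) = F t + j%:~R * q.
Proof.
move=> FD.
have Fn (n : nat) t : F (t + n%:R * p) = F t + n%:R * q.
  elim: n => [|n IH]; first by rewrite !mul0r !addr0.
  have -> : t + n.+1%:R * p = (t + n%:R * p) + p by ring.
  by rewrite FD IH; ring.
move=> [n|n] t; first exact: Fn.
rewrite NegzE !mulrNz !mulNr.
have := Fn n.+1 (t - n.+1%:R * p); rewrite subrK => ->.
by rewrite addrK.
Qed.

Lemma cos2D_int (R : realType) (j : int) (t : R) :
  cos (t + j%:~R * pi) ^+ 2 = cos t ^+ 2.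
Proof.
have := @additive_int R (fun t => cos t ^+ 2) pi 0 _ j t.
rewrite mulr0 addr0; apply => s.
by rewrite cosDpi sqrrN addr0.
Qed.

Lemma pi_half_shift (R : realType) (t : R) :
  exists j : int, - (pi / 2) <= t - j%:~R * pi < pi / 2.
Proof.
exists (Num.floor (t / pi + 1 / 2)).
have p0 := @pi_gt0 R.
have /andP[] := floor_itv (t / pi + 1 / 2); rewrite rmorphD/=.
set j := (Num.floor _)%:~R : R.
rewrite mulr1z => h1 h2.
have E : t = (t / pi) * pi by rewrite divfK// gt_eqF.
rewrite [X in X - _]E; set u := t / pi in h1 h2 *.
apply/andP; split; nra.
Qed.

Lemma theta_lt (R : realType) (g M : R) (X theta : R -> R) (x y : R) :
  is_time g M X theta -> (theta x < theta y) = (x < y).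
Proof. by move=> [_ _ thK Xlt _]; rewrite -Xlt !thK. Qed.

Lemma theta_le (R : realType) (g M : R) (X theta : R -> R) (x y : R) :
  is_time g M X theta -> (theta x <= theta y) = (x <= y).
Proof. by move=> H; rewrite !leNgt (theta_lt _ _ H). Qed.

Lemma time_pihalf_int (R : realType) (g M : R) (X theta : R -> R) (j : int) :
  is_time g M X theta ->
  X (- (pi / 2) + j%:~R * pi) = (2 * j%:~R - 1) * halfperiod g M.
Proof.
move=> [_ _ _ _ [_ XN XD XT]].
by rewrite (additive_int XD) XN XT; ring.
Qed.

Lemma theta_tile (R : realType) (g M : R) (X theta : R -> R) (j : int) (x : R) :
  is_time g M X theta ->
  (2 * j%:~R - 1) * halfperiod g M < x < (2 * j%:~R + 1) * halfperiod g M ->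
  - (pi / 2) < theta x - j%:~R * pi < pi / 2.
Proof.
move=> H; have [dX XK thK Xlt _] := H.
have E : (2 * j%:~R + 1) * halfperiod g M = X (- (pi / 2) + (j + 1)%:~R * pi).
  by rewrite (time_pihalf_int _ H) rmorphD/=; ring.
rewrite -(time_pihalf_int _ H) E -{1 2}(thK x) !Xlt rmorphD/= => /andP[h1 h2].
by apply/andP; split; lra.
Qed.

Lemma cos_tile_gt0 (R : realType) (g M : R) (X theta : R -> R) (j : int) (x : R) :
  is_time g M X theta ->
  (2 * j%:~R - 1) * halfperiod g M < x < (2 * j%:~R + 1) * halfperiod g M ->
  0 < cos (theta x - j%:~R * pi).
Proof. by move=> H /(theta_tile H) /cos_gt0_pihalf. Qed.

Lemma cos2_shift (R : realType) (j : int) (t : R) :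
  cos (t - j%:~R * pi) ^+ 2 = cos t ^+ 2.
Proof. by rewrite -[in RHS](subrK (j%:~R * pi) t) cos2D_int. Qed.

Lemma halfperiod_gt0 (R : realType) (g M : R) (X theta : R -> R) :
  is_time g M X theta -> 0 < halfperiod g M.
Proof.
move=> [_ _ _ Xlt [_ XN _ XT]].
have X0 : X 0 = 0 by have := XN 0; rewrite oppr0; lra.
by rewrite -XT -X0 Xlt divr_gt0// pi_gt0.
Qed.

Definition film {R : realType} (theta : R -> R) (x : R) : R := cos (theta x) ^+ 2.

(** A multiple of pi moves the angle into [- pi / 2, pi / 2), where cos vanishes only at the left
    end; so each zero is the left end of exactly the tile selected by that multiple. *)
Lemma film_eq0 (R : realType) (g M : R) (X theta : R -> R) (x : R) :
  is_time g M X theta ->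
  film theta x = 0 <-> exists j : int, x = (2 * j%:~R - 1) * halfperiod g M.
Proof.
move=> H; have [dX XK thK Xlt _] := H; split; last first.
  move=> [j ->]; rewrite -(time_pihalf_int _ H) /film XK cos2D_int cosN cos_pihalf.
  by rewrite expr0n.
move=> h0; have [j /andP[h1 h2]] := pi_half_shift (theta x).
exists j; rewrite -(time_pihalf_int _ H) -{1}(thK x); congr X.
move: h1; rewrite le_eqVlt => /predU1P[->|h1]; first by rewrite subrK.
have : 0 < cos (theta x - j%:~R * pi) by apply: cos_gt0_pihalf; rewrite h1.
by move=> /(exprn_gt0 2); rewrite cos2_shift -/(film theta x) h0 ltxx.
Qed.

Lemma film_even (R : realType) (g M : R) (X theta : R -> R) (x : R) :
  is_time g M X theta -> film theta (- x) = film theta x.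
Proof.
move=> [dX XK thK Xlt [_ XN _ _]].
rewrite /film; have -> : theta (- x) = - theta x by rewrite -{1}(thK x) -XN XK.
by rewrite cosN.
Qed.

Lemma film_periodic (R : realType) (g M : R) (X theta : R -> R) (x : R) :
  is_time g M X theta -> film theta (x + 2 * halfperiod g M) = film theta x.
Proof.
move=> [dX XK thK Xlt [_ _ XD _]].
by rewrite /film -{1}(thK x) -XD XK cosDpi sqrrN.
Qed.

Lemma film_nondecreasing (R : realType) (g M : R) (X theta : R -> R) (x y : R) :
  is_time g M X theta -> - halfperiod g M <= x -> x <= y -> y < 0 ->
  film theta x <= film theta y.
Proof.
move=> H; have [dX XK thK Xlt [_ XN _ XT]] := H => Tx xy y0.
have X0 : X 0 = 0 by have := XN 0; rewrite oppr0; lra.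
have h1 : - (pi / 2) <= theta x.
  by rewrite -[X in X <= _]XK (theta_le _ _ H) XN XT.
have h2 : theta x <= theta y by rewrite (theta_le _ _ H).
have h3 : theta y < 0 by rewrite -[X in _ < X]XK X0 (theta_lt _ _ H).
have p0 := @pi_gt0 R.
have c0 (t : R) : - (pi / 2) <= t -> t < 0 -> 0 <= cos t.
  by move=> t1 t2; apply: cos_ge0_pihalf; rewrite t1/=; lra.
rewrite /film ler_pXn2r ?nnegrE ?c0//; try lra.
rewrite -cosN -[leRHS]cosN leNgt ltr_cos ?in_itv/=; [|lra|lra].
by rewrite -leNgt lerN2.
Qed.

Lemma open_positivity_set (R : realType) (h : R -> R) :
  continuous h -> open (positivity_set h).
Proof.
move=> ch; apply: (@open_comp _ _ h [set z | 0 < z]).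
  by move=> y _; exact: ch.
exact: open_gt.
Qed.

(** * Classical derivatives of the film *)

Definition film1 {R : realType} (g M : R) (theta : R -> R) (x : R) : R :=
  etafun g M (theta x).

Lemma continuous_film (R : realType) (g M : R) (X theta : R -> R) :
  is_time g M X theta -> continuous (film theta).
Proof.
move=> [_ _ _ _ [cth _ _ _]] x.
apply: (@continuous_at_comp R (fun c => c ^+ 2) (fun x => cos (theta x)) x).
  apply: (@continuous_at_comp R cos theta x); first exact: cth.
  exact: continuous_cos.
exact: exprn_continuous.
Qed.

Lemma continuous_film1 (R : realType) (g M : R) (X theta : R -> R) :
  0 < g -> g < M -> is_time g M X theta -> continuous (film1 g M theta).
Proof.
move=> g0 gM [_ _ _ _ [cth _ _ _]] x.
apply: (@continuous_at_comp R (etafun g M) theta x); first exact: cth.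
exact: continuous_etafun.
Qed.

Lemma film1_eq0 (R : realType) (g M : R) (theta : R -> R) (x : R) :
  film theta x = 0 -> film1 g M theta x = 0.
Proof.
move=> /eqP; rewrite expf_eq0/= => /eqP c0.
by rewrite /film1 /etafun c0 mulr0 oppr0 mul0r.
Qed.

(* [film1] has a primitive P. As functions of t, both P(X(t)) and cos(t)^2 have
   derivative [etafun t * wfun t], even where X'(t) = 0 and theta is not
   differentiable. *)
Lemma is_derive_film (R : realType) (g M : R) (X theta : R -> R) :
  0 < g -> g < M -> is_time g M X theta ->
  forall x : R, is_derive x 1 (film theta) (film1 g M theta x).
Proof.
move=> g0 gM H; have [dX XK thK _ _] := H.
have [P dP] := exists_primitive (continuous_film1 g0 gM H).
have dPX (t : R) : is_derive t 1 (fun t => P (X t)) (etafun g M t * wfun g M t).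
  have := is_derive_comp (dX t) (dP (X t)).
  by rewrite /film1 XK.
have dc (t : R) : is_derive t 1 (fun t => cos t * cos t) (etafun g M t * wfun g M t).
  have := is_derive_mul (is_derive_cos t) (is_derive_cos t).
  by move/is_derive_eq; apply; rewrite etafun_mul//; ring.
pose c := P (X 0) - cos 0 * cos 0.
have E : film theta = (fun x => P x - c).
  apply/funext => x; have := primitive_unique (theta x) 0 dPX dc.
  by rewrite /film thK expr2 /c; lra.
move=> x; rewrite E.
have := is_derive_sub (dP x) (is_derive_cst c x 1).
by rewrite subr0.
Qed.

Lemma is_derive_theta (R : realType) (g M : R) (X theta : R -> R) (x : R) :
  0 < g -> g < M -> is_time g M X theta -> cos (theta x) != 0 ->
  is_derive x 1 theta (wfun g M (theta x))^-1.
Proof.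
move=> g0 gM [dX XK thK _ _] ct; rewrite -[x in is_derive x](thK x).
apply: is_derive_inverse.
- by near=> y; exact: XK.
- by near=> t; exact: is_derive_continuous (dX t).
- by rewrite gt_eqF// wfun_gt0.
Unshelve. all: by end_near. Qed.

(** Continuity freezes the sign of [f] near [x], so there [f] is that sign times the root of its
    square. This allows the energy identity, which knows only h'^2, to be differentiated. *)
Lemma is_derive_of_sqr (R : realType) (f : R -> R) (x c : R) :
  {for x, continuous f} -> f x != 0 ->
  is_derive x 1 (fun y => f y ^+ 2) (2 * f x * c) -> is_derive x 1 f c.
Proof.
move=> cf fx0 df.
have near_sg : \forall y \near x, Num.sg (f x) * Num.sqrt (f y ^+ 2) = f y.
  have : \forall y \near x, `|f x - f y| < `|f x|.
    by move/cvgrPdist_lt : cf; apply; rewrite normr_gt0.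
  apply: filterS => y; rewrite sqrtr_sqr.
  have [h|h|h] := ltgtP (f x) 0; last by rewrite h eqxx in fx0.
    rewrite (ltr0_norm h) ltr_norml => /andP[h1 h2].
    by rewrite ltr0_sg// mulN1r ltr0_norm ?opprK//; lra.
  rewrite (gtr0_norm h) ltr_norml => /andP[h1 h2].
  by rewrite gtr0_sg// mul1r gtr0_norm//; lra.
apply: near_eq_is_derive near_sg _.
have f20 : 0 < f x ^+ 2 by rewrite exprn_even_gt0.
have := is_derive_scale (Num.sg (f x)) (is_derive_comp df (is_derive1_sqrt f20)).
move/is_derive_eq; apply.
have n0 : `|f x| != 0 by rewrite normr_eq0.
rewrite sqrtr_sqr; transitivity (Num.sg (f x) * f x / `|f x| * c); first by field.
by rewrite -normrEsg divff// mul1r.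
Qed.

(** When the differentiable factor vanishes at [x], continuity of the other one suffices: the
    Caratheodory slope function of [f] is multiplied by [k]. *)
Lemma is_derive_mul_zero (R : realType) (f k : R -> R) (x a : R) :
  is_derive x 1 f a -> f x = 0 -> {for x, continuous k} ->
  is_derive x 1 (fun y => f y * k y) (a * k x).
Proof.
move=> /is_derive1_caratheodory[q [fq cq qx]] fx0 ck.
apply/is_derive1_caratheodory; exists (fun y => q y * k y); split.
- by move=> z; rewrite fx0 mul0r subr0 -[f z]subr0 -[X in _ - X]fx0 fq; ring.
- exact: (continuousM cq ck).
- by rewrite qx.
Qed.

(* The second derivative of the film as a function of its height h. *)
Definition curv {R : realType} (g M h : R) : R :=
  M * ell h - g / 2 + g * h - M / (1 + h).

(** Off the crests h' is nonzero and the differentiated energy identity can be divided by 2 h'. At a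
    crest sin(theta) = 0, and h' is written as sin(theta) times a factor [k] for which continuity is
    enough. *)
Lemma is_derive_film1 (R : realType) (g M : R) (X theta : R -> R) (x : R) :
  0 < g -> g < M -> is_time g M X theta -> 0 < film theta x ->
  is_derive x 1 (film1 g M theta) (curv g M (film theta x)).
Proof.
move=> g0 gM H h0; have [dX XK thK _ [cth _ _ _]] := H.
have ct : cos (theta x) != 0.
  by apply: contraTneq h0 => c0; rewrite /film c0 expr0n ltxx.
have dth := is_derive_theta g0 gM H ct.
have [st|st] := eqVneq (sin (theta x)) 0.
  pose k y := - (2 * cos (theta y)) / wfun g M (theta y).
  have E : film1 g M theta = (fun y => sin (theta y) * k y).
    by apply/funext => y; rewrite /film1 /etafun /k; ring.
  have ck : {for x, continuous k}.
    apply: continuousM.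
      apply: continuousN; apply: continuousM; first exact: cst_continuous.
      apply: (@continuous_at_comp R cos theta x); first exact: cth.
      exact: continuous_cos.
    apply: continuousV; first by rewrite gt_eqF// wfun_gt0.
    apply: (@continuous_at_comp R (wfun g M) theta x); first exact: cth.
    exact: continuous_wfun.
  rewrite E; have := is_derive_mul_zero (is_derive_comp dth (is_derive_sin (theta x))) st ck.
  move/is_derive_eq; apply; rewrite /k.
  have h1 : cos (theta x) ^+ 2 = 1 by rewrite cos2sin2 st expr0n subr0.
  have w0 := wfun_gt0 g0 gM ct.
  have -> : cos (theta x) / wfun g M (theta x) *
     (- (2 * cos (theta x)) / wfun g M (theta x)) =
     - 2 * cos (theta x) ^+ 2 / wfun g M (theta x) ^+ 2.
    by field; rewrite gt_eqF.
  (* At the crest [wfun] squared is 4 / (M - g), so both sides equal (g - M) / 2. *)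
  rewrite wfun2// /film h1 /curv ell1.
  have -> : vfun (1 : R) = 2 by rewrite /vfun (lt_geF ltr01) lexx.
  by field; rewrite gt_eqF//; lra.
have oU : open (positivity_set (film theta)).
  exact: open_positivity_set (continuous_film H).
have nh : \forall y \near x, 2 * film theta y *
    (M * ell (film theta y) - g * (1 - film theta y) / 2) = film1 g M theta y ^+ 2.
  have := open_nbhs_nbhs (conj oU h0); apply: filterS => y /= hy.
  rewrite /film1 etafun_sqr//.
  by apply: contraTneq hy => c0; rewrite /film c0 expr0n ltxx.
have f1 : film1 g M theta x != 0.
  rewrite /film1 /etafun mulf_neq0//; last first.
    by rewrite invr_eq0 gt_eqF// wfun_gt0.
  by rewrite oppr_eq0 !mulf_neq0.
apply: (@is_derive_of_sqr R (film1 g M theta) x _ _ f1).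
  exact: continuous_film1 H _.
apply: near_eq_is_derive nh _.
have dh := is_derive_film g0 gM H x.
have de := is_derive_comp dh (is_derive_ell h0).
have d1 := is_derive_sub (is_derive_cst (1 : R) x 1) dh.
have d2 := is_derive_sub (is_derive_scale M de) (is_derive_scale (g / 2) d1).
have d3 := is_derive_mul (is_derive_scale 2 dh) d2.
have -> : (fun y => 2 * film theta y *
    (M * ell (film theta y) - g * (1 - film theta y) / 2)) =
  (fun y => 2 * film theta y *
    (M * ell (film theta y) - g / 2 * (cst 1 y - film theta y))).
  by apply/funext => y /=; field.
move: d3 => /is_derive_eq; apply; rewrite /curv /=.
set h := film theta x in h0 *; set e := ell h; set p := film1 g M theta x.
by field; rewrite !gt_eqF//; lra.
Qed.

Lemma is_derive_curv (R : realType) (g M : R) (X theta : R -> R) (x : R) :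
  0 < g -> g < M -> is_time g M X theta -> 0 < film theta x ->
  is_derive x 1 (fun y => curv g M (film theta y))
    (g * film1 g M theta x -
     M * film1 g M theta x / (film theta x * (1 + film theta x) ^+ 2)).
Proof.
move=> g0 gM H h0.
have dh := is_derive_film g0 gM H x.
have de := is_derive_comp dh (is_derive_ell h0).
have d1 := is_derive_add (is_derive_cst (1 : R) x 1) dh.
have n1 : (cst 1 x + film theta x : R) != 0 by rewrite gt_eqF//= ; lra.
have d2 := is_derive_scale M
  (@is_derive_inv R (fun y => cst 1 y + film theta y) x _ n1 d1).
have d3 := is_derive_sub (is_derive_scale M de) (is_derive_cst (g / 2) x 1).
have d4 := is_derive_sub (is_derive_add d3 (is_derive_scale g dh)) d2.
move: d4 => /is_derive_eq; apply; rewrite /cst /=.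
set h := film theta x in h0 n1 *; set p := film1 g M theta x.
by field; rewrite !gt_eqF//; lra.
Qed.

(* [quartic_gap (sin t)] is bounded, while its derivative in t is at least
   [1 / (4 * sqrt (cos t))] where cos t > 0: this makes [1 / sqrt |cos theta|],
   and with it every power of the logarithmic singularity, integrable. *)
Definition quartic_gap {R : realType} (s : R) : R :=
  Num.sqrt (Num.sqrt (1 + s)) - Num.sqrt (Num.sqrt (1 - s)).

Definition quartic_gap1 {R : realType} (s : R) : R :=
  ((Num.sqrt (Num.sqrt (1 + s)) * Num.sqrt (1 + s))^-1 +
   (Num.sqrt (Num.sqrt (1 - s)) * Num.sqrt (1 - s))^-1) / 4.

Lemma continuous_quartic_gap (R : realType) : continuous (@quartic_gap R).
Proof.
have c4 (f : R -> R) (x : R) : {for x, continuous f} ->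
    {for x, continuous (fun y => Num.sqrt (Num.sqrt (f y)))}.
  move=> cf; apply: (@continuous_at_comp R Num.sqrt (fun y => Num.sqrt (f y)) x).
    apply: (@continuous_at_comp R Num.sqrt f x cf); exact: sqrt_continuous.
  exact: sqrt_continuous.
move=> s; apply: (@continuous_at_sub R (fun y => Num.sqrt (Num.sqrt (1 + y)))
  (fun y => Num.sqrt (Num.sqrt (1 - y))) s); apply: c4.
  by apply: continuousD => //; exact: cst_continuous.
by apply: continuousB => //; exact: cst_continuous.
Qed.

Lemma is_derive_sqrt_sqrt (R : realType) (u : R) : 0 < u ->
  is_derive u 1 (fun u => Num.sqrt (Num.sqrt u))
    ((Num.sqrt (Num.sqrt u) * Num.sqrt u)^-1 / 4).
Proof.
move=> u0; have s0 : 0 < Num.sqrt u by rewrite sqrtr_gt0.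
have := is_derive_comp (is_derive1_sqrt u0) (is_derive1_sqrt s0).
move/is_derive_eq; apply; field.
by rewrite !gt_eqF// sqrtr_gt0.
Qed.

Lemma is_derive_quartic_gap (R : realType) (s : R) : -1 < s < 1 ->
  is_derive s 1 quartic_gap (quartic_gap1 s).
Proof.
move=> /andP[s1 s2].
have p1 : 0 < 1 + s by lra.
have p2 : 0 < 1 - s by lra.
have d1 := is_derive_comp
  (is_derive_add (is_derive_cst (1 : R) s 1) (is_derive_id s 1)) (is_derive_sqrt_sqrt p1).
have d2 := is_derive_comp
  (is_derive_sub (is_derive_cst (1 : R) s 1) (is_derive_id s 1)) (is_derive_sqrt_sqrt p2).
have := is_derive_sub d1 d2.
by move/is_derive_eq; apply; rewrite /quartic_gap1; ring.
Qed.

Lemma continuous_quartic_gap1 (R : realType) (s : R) : -1 < s < 1 ->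
  {for s, continuous (@quartic_gap1 R)}.
Proof.
move=> /andP[s1 s2].
have c1 (f : R -> R) (x : R) : {for x, continuous f} -> 0 < f x ->
    {for x, continuous (fun y => (Num.sqrt (Num.sqrt (f y)) * Num.sqrt (f y))^-1)}.
  move=> cf f0.
  have cs : {for x, continuous (fun y => Num.sqrt (f y))}.
    apply: (@continuous_at_comp R Num.sqrt f x cf); exact: sqrt_continuous.
  apply: continuousV; first by rewrite gt_eqF// mulr_gt0// !sqrtr_gt0.
  apply: continuousM => //.
  apply: (@continuous_at_comp R Num.sqrt (fun y => Num.sqrt (f y)) x cs).
  exact: sqrt_continuous.
suff : {for s, continuous (fun s : R => ((Num.sqrt (Num.sqrt (1 + s)) * Num.sqrt (1 + s))^-1 +
   (Num.sqrt (Num.sqrt (1 - s)) * Num.sqrt (1 - s))^-1) * 4^-1)} by [].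
apply: continuousM; last exact: cst_continuous.
apply: continuousD; apply: c1; try lra.
  by apply: continuousD => //; exact: cst_continuous.
by apply: continuousB => //; exact: cst_continuous.
Qed.

(** As cos^2 = (1 - sin) (1 + sin), the smaller of 1 - sin and 1 + sin is at most cos^2. Its power
    -3/4 is then at least cos^(-3/2), and the factor cos turns this into cos^(-1/2). *)
Lemma quartic_gap1_ge (R : realType) (t : R) : 0 < cos t ->
  (Num.sqrt (cos t))^-1 <= 4 * (quartic_gap1 (sin t) * cos t).
Proof.
move=> c0; set c := cos t in c0 *; set s := sin t.
have cs : c ^+ 2 = (1 - s) * (1 + s) by rewrite /c cos2sin2 -/s; ring.
have c2 : 0 < c ^+ 2 by rewrite exprn_gt0.
have sc0 : 0 < Num.sqrt c by rewrite sqrtr_gt0.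
pose q (u : R) := (Num.sqrt (Num.sqrt u) * Num.sqrt u)^-1.
have q0 u : 0 <= q u by rewrite invr_ge0 mulr_ge0// sqrtr_ge0.
have key u : 0 < u -> u <= c ^+ 2 -> (Num.sqrt c)^-1 <= q u * c.
  move=> u0 uc.
  have h1 : Num.sqrt u <= c by rewrite -[leRHS]ger0_norm ?(ltW c0)// -sqrtr_sqr ler_wsqrtr.
  have h2 : Num.sqrt (Num.sqrt u) <= Num.sqrt c by rewrite ler_wsqrtr.
  have h3 : 0 < Num.sqrt (Num.sqrt u) * Num.sqrt u by rewrite mulr_gt0// !sqrtr_gt0.
  have h4 : Num.sqrt (Num.sqrt u) * Num.sqrt u <= Num.sqrt c * c.
    by apply: ler_pM => //; exact: sqrtr_ge0.
  have -> : (Num.sqrt c)^-1 = (Num.sqrt c * c)^-1 * c by field; rewrite !gt_eqF.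
  by rewrite ler_pM2r// /q lef_pV2 ?posrE// mulr_gt0.
have s1 := sin_le1 t; have s2 := sin_geN1 t; rewrite -/s in s1 s2.
have -> : 4 * (quartic_gap1 s * c) = q (1 + s) * c + q (1 - s) * c.
  by rewrite /quartic_gap1 -/(q (1 + s)) -/(q (1 - s)); field.
have qc u : 0 <= q u * c by rewrite mulr_ge0// ltW.
have [s0|s0] := leP 0 s.
  have := key (1 - s) _ _; have := qc (1 + s).
  move=> h1 h2; apply: (le_trans (h2 _ _)); [nra|nra|by rewrite lerDr].
have := key (1 + s) _ _; have := qc (1 - s).
move=> h1 h2; apply: (le_trans (h2 _ _)); [nra|nra|by rewrite lerDl].
Qed.

(** As a function of x, [quartic_gap] of the sine stays continuous up to the tile ends, and its
    derivative dominates a multiple of 1 / sqrt |cos(theta)|: the extra factor 1 / [wfun] from the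
    chain rule is bounded below by [wfun_le]. [ge0_improper_integral_le] then gives an integrable
    majorant of [f]. *)
Lemma integrable_tile_of_le (R : realType) (g M : R) (X theta f : R -> R) (C : R)
    (j : int) :
  0 < g -> g < M -> is_time g M X theta -> 0 <= C ->
  measurable_fun setT f ->
  (forall x, 0 < film theta x -> `|f x| <= C / Num.sqrt `|cos (theta x)|) ->
  (@lebesgue_measure R).-integrable
    `[(2 * j%:~R - 1) * halfperiod g M, (2 * j%:~R + 1) * halfperiod g M]
    (EFin \o f).
Proof.
move=> g0 gM H C0 mf fC; have [dX XK thK _ [cth _ _ _]] := H.
have T0 := halfperiod_gt0 H.
set a := (_ - 1) * _; set b := (_ + 1) * _.
have ab : a < b by rewrite /a /b ltr_pM2r//; lra.
(* Removing j pi makes the cosine positive on the tile, as [quartic_gap1_ge] demands, and keeps its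
   absolute value. *)
pose tau x := theta x - j%:~R * pi.
pose E x := quartic_gap (sin (tau x)).
pose e x := quartic_gap1 (sin (tau x)) * (cos (tau x) * (wfun g M (theta x))^-1).
have ctau x : a < x < b -> 0 < cos (tau x) by exact: (cos_tile_gt0 H).
have cth0 x : a < x < b -> cos (theta x) != 0.
  move=> /ctau; apply: contraTneq => c0.
  have := cos2_shift j (theta x); rewrite c0 expr0n/= => /eqP; rewrite expf_eq0/=.
  by move=> /eqP h; rewrite /tau h ltxx.
have stau x : a < x < b -> -1 < sin (tau x) < 1.
  move=> /ctau c0; have := cos2Dsin2 (tau x).
  have : 0 < cos (tau x) ^+ 2 by rewrite exprn_gt0.
  by move=> h1 h2; apply/andP; split; nra.
have ctaux : continuous tau.
  by move=> x; apply: (@continuous_at_sub R theta (fun=> j%:~R * pi) x);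
    [exact: cth|exact: cst_continuous].
have cstau : continuous (fun x => sin (tau x)).
  move=> x; apply: (@continuous_at_comp R sin tau x); first exact: ctaux.
  exact: continuous_sin.
have cE : {within `[a, b], continuous E}.
  apply: continuous_subspaceT => x.
  apply: (@continuous_at_comp R quartic_gap (fun x => sin (tau x)) x); first exact: cstau.
  exact: continuous_quartic_gap.
have dE (x : R) : a < x < b -> is_derive x 1 E (e x).
  move=> xab.
  have dth := is_derive_theta g0 gM H (cth0 x xab).
  have dt := is_derive_sub dth (is_derive_cst (j%:~R * pi : R) x 1).
  rewrite subr0 in dt.
  have ds := is_derive_comp dt (is_derive_sin (tau x)).
  exact: is_derive_comp ds (is_derive_quartic_gap (stau x xab)).
have ce (x : R) : a < x < b -> {for x, continuous e}.
  move=> xab; apply: continuousM.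
    apply: (@continuous_at_comp R quartic_gap1 (fun x => sin (tau x)) x); first exact: cstau.
    exact: continuous_quartic_gap1 (stau x xab).
  apply: continuousM.
    apply: (@continuous_at_comp R cos tau x); first exact: ctaux.
    exact: continuous_cos.
  apply: continuousV; first by rewrite gt_eqF// wfun_gt0// cth0.
  apply: (@continuous_at_comp R (wfun g M) theta x); first exact: cth.
  exact: continuous_wfun.
pose W := 2 / Num.sqrt (M - g).
have W0 : 0 < W by rewrite divr_gt0// sqrtr_gt0 subr_gt0.
have eb (x : R) : a < x < b -> (Num.sqrt `|cos (theta x)|)^-1 <= 4 * W * e x.
  move=> xab; have c0 := ctau x xab.
  have -> : `|cos (theta x)| = cos (tau x).
    rewrite -[RHS]ger0_norm ?(ltW c0)//.
    by apply/eqP; rewrite -(@eqrXn2 _ 2)// !real_normK ?num_real// cos2_shift.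
  have := quartic_gap1_ge c0; move/le_trans; apply.
  have w0 := wfun_gt0 g0 gM (cth0 x xab).
  have -> : 4 * (quartic_gap1 (sin (tau x)) * cos (tau x)) =
            4 * wfun g M (theta x) * e x by rewrite /e; field; rewrite gt_eqF.
  have e0 : 0 <= e x.
    rewrite /e mulr_ge0 ?mulr_ge0 ?invr_ge0 ?(ltW w0) ?(ltW c0)//.
  by rewrite ler_wpM2r// ler_pM2l// wfun_le.
have e0 (x : R) : a < x < b -> 0 <= e x.
  move=> xab; have := eb x xab; have : 0 < 4 * W by rewrite mulr_gt0.
  move=> h1 h2; rewrite -(pmulr_rge0 _ h1); apply: le_trans h2.
  by rewrite invr_ge0 sqrtr_ge0.
have le1 := ge0_improper_integral_le ab cE dE ce e0.
have ei : (@lebesgue_measure R).-integrable `]a, b[ (EFin \o e).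
  apply/integrableP; split.
    apply/measurable_EFinP; apply: open_continuous_measurable_fun => // x.
    by rewrite inE/= in_itv/=; exact: ce.
  apply: le_lt_trans (ltry (E b - E a)); apply: le_trans le1.
  rewrite le_eqVlt; apply/orP; left; apply/eqP; apply: eq_integral => x.
  by rewrite inE/= in_itv/= => /e0 ex; rewrite ger0_norm.
have fi : (@lebesgue_measure R).-integrable `]a, b[ (EFin \o f).
  apply: (integrable_dominated (k := C * (4 * W)) _ _ _ ei) => //.
  - exact: measurable_funTS.
  - move=> x; rewrite /= in_itv/= => xab.
    apply: le_trans (fC x _) _; first by rewrite exprn_even_gt0//= cth0.
    by rewrite -mulrA ler_wpM2l// eb.
apply/integrableP; split; first by apply/measurable_EFinP; exact: measurable_funTS.
rewrite integral_itv_bndoo; first by have /integrableP[] := fi.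
apply: measurableT_comp => //.
by apply/measurable_EFinP; exact: measurable_funTS.
Qed.

Lemma ell_ge0 (R : realType) (h : R) : 0 < h <= 1 -> 0 <= ell h.
Proof.
by move=> /andP[h0 h1]; apply: le_trans (ell_ge h0); rewrite divr_ge0//; lra.
Qed.

(** The exponent in z = y^(- 1 / (2 p)) is chosen so that z^p = y^(- 1/2). Then ell(y^2) <= 2 ln (1
    / y) = 4 p ln z <= 4 p z, and z >= 1 absorbs the bounded terms of [curv] into the constant. Here
    y stands for |cos(theta)|. *)
Lemma curv_powR_le (R : realType) (g M p y : R) : 0 < g -> g < M -> 1 <= p ->
  0 < y <= 1 ->
  `|curv g M (y ^+ 2)| `^ p <= (4 * p * M + 2 * g + M) `^ p / Num.sqrt y.
Proof.
move=> g0 gM p1 /andP[y0 y1].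
have p0 : 0 < p by lra.
pose z := y `^ (- (2 * p)^-1).
have z0 : 0 < z by exact: powR_gt0.
have z1 : 1 <= z.
  rewrite -[z]lnK ?posrE//; apply: le_trans (expR_ge1Dx _).
  rewrite lerDl ln_powR mulr_le0 ?ln_le0//.
  by rewrite oppr_le0 invr_ge0; lra.
have h0 : 0 < y ^+ 2 by rewrite exprn_gt0.
have h1 : y ^+ 2 <= 1 by rewrite exprn_ile1// ltW.
have e0 : 0 <= ell (y ^+ 2) by rewrite ell_ge0// h0.
have e1 : ell (y ^+ 2) <= 4 * p * z.
  have H2 : ln z < z by exact: ln_sublinear.
  have lz : ln z = - (2 * p)^-1 * ln y by rewrite /z ln_powR.
  have -> : ell (y ^+ 2) = ln ((1 + y ^+ 2) / 2) + 4 * p * ln z.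
    rewrite lz (_ : 4 * p * _ = 2 * ln y^-1); last first.
      by rewrite lnV ?posrE//; field; rewrite gt_eqF.
    rewrite mulr_natl -lnXn ?posrE ?invr_gt0// -lnM ?posrE; last 2 first.
    - by rewrite divr_gt0//; lra.
    - by rewrite exprn_gt0// invr_gt0.
    by rewrite /ell; congr ln; field; rewrite gt_eqF.
  have H1 : ln ((1 + y ^+ 2) / 2) <= 0 by apply: ln_le0; lra.
  have : 4 * p * ln z <= 4 * p * z by rewrite ler_pM2l ?(ltW H2)//; lra.
  lra.
have M0 : 0 < M by lra.
set C := 4 * p * M + 2 * g + M.
have C0 : 0 < C by rewrite /C; nra.
have fC : `|curv g M (y ^+ 2)| <= C * z.
  have q1 : 0 <= M / (1 + y ^+ 2) <= M.
    rewrite divr_ge0 ?(ltW M0)//=; last lra.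
    by rewrite ler_pdivrMr; nra.
  have q2 : 0 <= M * ell (y ^+ 2) <= 4 * p * M * z.
    rewrite mulr_ge0 ?(ltW M0)//= (_ : 4 * p * M * z = M * (4 * p * z)); last ring.
    by rewrite ler_pM2l.
  move: q1 q2 => /andP[q1 q2] /andP[q3 q4].
  rewrite /curv /C ler_norml; apply/andP; split; nra.
apply: (@le_trans _ _ ((C * z) `^ p)).
  by rewrite ge0_ler_powR ?nnegrE// ?mulr_ge0 ?(ltW C0) ?(ltW z0)//; exact: ltW.
rewrite powRM ?(ltW C0) ?(ltW z0)// ler_pM2l ?powR_gt0//.
rewrite /z -powRrM (_ : - (2 * p)^-1 * p = - 2^-1); last by field; rewrite gt_eqF.
by rewrite powRN powR12_sqrt// ltW.
Qed.

(** * Weak derivatives of the film and the flux *)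

Lemma near_patch (R : realType) (U : set R) (f : R -> R) (x : R) :
  open U -> U x -> \forall y \near x, f y = (f \_ U) y.
Proof.
move=> oU Ux; have := open_nbhs_nbhs (conj oU Ux); apply: filterS => y Uy.
by rewrite patchE mem_set.
Qed.

(** The excluded points carry the logarithmic singularity. Extension by 0 from the open set {h > 0},
    on which the function is continuous, makes it measurable on the line. *)
Definition film2 {R : realType} (g M : R) (theta : R -> R) : R -> R :=
  (fun x => curv g M (film theta x)) \_ (positivity_set (film theta)).

Definition film3 {R : realType} (g M : R) (theta : R -> R) : R -> R :=
  (fun x => g * film1 g M theta x -
     M * film1 g M theta x / (film theta x * (1 + film theta x) ^+ 2))
  \_ (positivity_set (film theta)).

Lemma patch_notin (R : realType) (f : R -> R) (V : set R) (x : R) :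
  ~ V x -> (f \_ V) x = 0.
Proof. by move=> Vx; rewrite patchE memNset. Qed.

Lemma film2E (R : realType) (g M : R) (theta : R -> R) (x : R) :
  0 < film theta x -> film2 g M theta x = curv g M (film theta x).
Proof. by move=> hx; rewrite /film2 patchE mem_set. Qed.

Lemma film3E (R : realType) (g M : R) (theta : R -> R) (x : R) :
  0 < film theta x -> film3 g M theta x = g * film1 g M theta x -
     M * film1 g M theta x / (film theta x * (1 + film theta x) ^+ 2).
Proof. by move=> hx; rewrite /film3 patchE mem_set. Qed.

Lemma open_film (R : realType) (g M : R) (X theta : R -> R) :
  is_time g M X theta -> open (positivity_set (film theta)).
Proof. by move=> H; exact: open_positivity_set (continuous_film H). Qed.

Lemma continuous_film2 (R : realType) (g M : R) (X theta : R -> R) (x : R) :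
  0 < g -> g < M -> is_time g M X theta -> 0 < film theta x ->
  {for x, continuous (film2 g M theta)}.
Proof.
move=> g0 gM H hx; apply: near_continuous_at (near_patch _ (open_film H) hx) _.
exact: is_derive_continuous (is_derive_curv g0 gM H hx).
Qed.

Lemma continuous_film3 (R : realType) (g M : R) (X theta : R -> R) (x : R) :
  0 < g -> g < M -> is_time g M X theta -> 0 < film theta x ->
  {for x, continuous (film3 g M theta)}.
Proof.
move=> g0 gM H hx; apply: near_continuous_at (near_patch _ (open_film H) hx) _.
have c1 := continuous_film1 g0 gM H (x := x).
have ch := continuous_film H (x := x).
apply: continuous_at_sub; first exact: (continuous_at_mul (@cst_continuous _ _ g x) c1).
apply: continuous_at_mul; first exact: (continuous_at_mul (@cst_continuous _ _ M x) c1).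
apply: continuousV; first by rewrite gt_eqF// mulr_gt0// exprn_gt0//; lra.
apply: (continuous_at_mul ch).
apply: (@continuous_at_comp R (fun c => c ^+ 2) (fun x => 1 + film theta x) x).
  by apply: continuousD => //; exact: cst_continuous.
exact: exprn_continuous.
Qed.

Lemma measurable_film2 (R : realType) (g M : R) (X theta : R -> R) :
  0 < g -> g < M -> is_time g M X theta ->
  measurable_fun setT (film2 g M theta).
Proof.
move=> g0 gM H; apply: (measurable_open_ext (open_film H)).
  by move=> x; exact: (continuous_film2 g0 gM H).
by move=> x; exact: patch_notin.
Qed.

Lemma measurable_film3 (R : realType) (g M : R) (X theta : R -> R) :
  0 < g -> g < M -> is_time g M X theta ->
  measurable_fun setT (film3 g M theta).
Proof.
move=> g0 gM H; apply: (measurable_open_ext (open_film H)).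
  by move=> x; exact: (continuous_film3 g0 gM H).
by move=> x; exact: patch_notin.
Qed.

Lemma film2_powR_integrable_tile (R : realType) (g M : R) (X theta : R -> R)
    (p : R) (j : int) :
  0 < g -> g < M -> is_time g M X theta -> 1 <= p ->
  (@lebesgue_measure R).-integrable
    `[(2 * j%:~R - 1) * halfperiod g M, (2 * j%:~R + 1) * halfperiod g M]
    (EFin \o (fun x => `|film2 g M theta x| `^ p)).
Proof.
move=> g0 gM H p1.
apply: (integrable_tile_of_le (C := (4 * p * M + 2 * g + M) `^ p) j g0 gM H).
- exact: powR_ge0.
- apply: (measurableT_comp (measurable_powR p)).
  by apply: measurableT_comp => //; exact: measurable_film2 H.
move=> x hx; rewrite ger0_norm ?powR_ge0// film2E//.
rewrite /film -[cos _ ^+ 2]real_normK ?num_real//.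
apply: curv_powR_le => //; rewrite normr_gt0 cos_max andbT.
by apply: contraTneq hx => c0; rewrite /film c0 expr0n ltxx.
Qed.

Lemma film2_integrable_tile (R : realType) (g M : R) (X theta : R -> R) (j : int) :
  0 < g -> g < M -> is_time g M X theta ->
  (@lebesgue_measure R).-integrable
    `[(2 * j%:~R - 1) * halfperiod g M, (2 * j%:~R + 1) * halfperiod g M]
    (EFin \o film2 g M theta).
Proof.
move=> g0 gM H.
have := film2_powR_integrable_tile j g0 gM H (lexx 1).
apply: (integrable_dominated (k := 1)) => //.
  by apply: measurable_funTS; exact: measurable_film2 H.
by move=> x _; rewrite mul1r powRr1.
Qed.

Lemma Lp_loc_film2 (R : realType) (g M : R) (X theta : R -> R) (p : R) :
  0 < g -> g < M -> is_time g M X theta -> 1 <= p ->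
  Lp_loc setT p (film2 g M theta).
Proof.
move=> g0 gM H p1; apply: Lp_loc_dominated; [lra|exact: measurable_film2 H|].
move=> K _ cK; exists (fun x => `|film2 g M theta x| `^ p) => //.
apply: (integrable_compact_tile (halfperiod_gt0 H)) cK => j.
exact: film2_powR_integrable_tile H p1.
Qed.

Lemma locally_integrable_film2 (R : realType) (g M : R) (X theta : R -> R) :
  0 < g -> g < M -> is_time g M X theta ->
  locally_integrable setT (film2 g M theta).
Proof.
move=> g0 gM H; split; [exact: measurable_film2 H|exact: openT|move=> K _ cK].
have := integrable_compact_tile (halfperiod_gt0 H)
  (fun j => film2_integrable_tile j g0 gM H) cK.
by move=> /integrableP[].
Qed.

Lemma weak_derivative0 (R : realType) (U : set R) (f : R -> R) :
  open U -> continuous f -> weak_derivative U 0 f f.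
Proof.
move=> oU cf.
have fi : locally_integrable U f.
  by apply: locally_integrable_continuous => // x _; exact: cf.
by split=> // phi _; rewrite expr0 mul1e.
Qed.

Lemma weak_derivative_film1 (R : realType) (g M : R) (X theta : R -> R) :
  0 < g -> g < M -> is_time g M X theta ->
  weak_derivative setT 1 (film theta) (film1 g M theta).
Proof.
move=> g0 gM H.
have ch := continuous_film H; have ch1 := continuous_film1 g0 gM H.
split; [exact: locally_integrable_continuous openT (fun x _ => ch x)|
        exact: locally_integrable_continuous openT (fun x _ => ch1 x)|].
move=> phi tphi; rewrite expr1 EFinN mulN1e.
exact: (integral_by_parts_test 0 tphi (fun x _ => is_derive_film g0 gM H x)
  (fun x _ => ch1 x)).
Qed.

(** Only the second integration by parts meets the singular points. It is done tile by tile, and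
    since h' is continuous and vanishes at the zeros of h, no point mass arises there. *)
Lemma weak_derivative_film2 (R : realType) (g M : R) (X theta : R -> R) :
  0 < g -> g < M -> is_time g M X theta ->
  weak_derivative setT 2 (film theta) (film2 g M theta).
Proof.
move=> g0 gM H.
have ch := continuous_film H; have ch1 := continuous_film1 g0 gM H.
split; [exact: locally_integrable_continuous openT (fun x _ => ch x)|
        exact: locally_integrable_film2 H|].
move=> phi tphi; rewrite sqrrN expr1n mul1e.
rewrite (integral_by_parts_test 1 tphi (fun x _ => is_derive_film g0 gM H x)
  (fun x _ => ch1 x)).
rewrite (integral_by_parts_test_tile (halfperiod_gt0 H) (a1 := film2 g M theta) ch1 tphi).
- by rewrite oppeK.
- by move=> j; apply: film1_eq0; apply/(film_eq0 _ H); exists j.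
- by move=> j; exact: film2_integrable_tile H.
- move=> j x xj; have hx : 0 < film theta x.
    rewrite /film -(cos2_shift j) exprn_gt0//; exact: cos_tile_gt0 H xj.
  split; last exact: continuous_film2 H hx.
  by rewrite (film2E g M hx); exact: (is_derive_film1 g0 gM H hx).
Qed.

(** The supports of the test functions avoid the zeros of h, so three classical integrations by
    parts suffice. *)
Lemma weak_derivative_film3 (R : realType) (g M : R) (X theta : R -> R) :
  0 < g -> g < M -> is_time g M X theta ->
  weak_derivative (positivity_set (film theta)) 3 (film theta) (film3 g M theta).
Proof.
move=> g0 gM H.
have ch := continuous_film H; have ch1 := continuous_film1 g0 gM H.
have oU := open_film H; set U := positivity_set _ in oU *.
have ch3 x : U x -> {for x, continuous (film3 g M theta)}.
  exact: continuous_film3 H.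
have d1 (x : R) : U x -> is_derive x 1 (film1 g M theta) (curv g M (film theta x)).
  exact: is_derive_film1 H.
have d2 (x : R) : U x -> is_derive x 1 (fun x => curv g M (film theta x))
    (film3 g M theta x).
  by move=> Ux; rewrite (film3E g M Ux); exact: (is_derive_curv g0 gM H Ux).
split; [exact: locally_integrable_continuous oU (fun x _ => ch x)|
        exact: locally_integrable_continuous oU ch3|].
move=> phi tphi.
rewrite (integral_by_parts_test 2 tphi (fun x _ => is_derive_film g0 gM H x)
  (fun x _ => ch1 x)).
rewrite (integral_by_parts_test 1 tphi d1 (fun x Ux => is_derive_continuous (d2 x Ux))).
rewrite (integral_by_parts_test 0 tphi d2 ch3).
by rewrite oppeK exprS sqrrN expr1n mulr1 EFinN mulN1e.
Qed.

(** After multiplication by h^3, the singular part of [film3] is exactly the negative of the M term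
    of the flux. *)
Lemma flux_film (R : realType) (g M : R) (theta : R -> R) (x : R) :
  0 < film theta x ->
  flux g M (film theta) (film1 g M theta) (film3 g M theta) x = 0.
Proof.
move=> hx; rewrite /flux film3E//.
set h := film theta x in hx *; set p := film1 g M theta x.
by field; rewrite !gt_eqF//; lra.
Qed.

Theorem theorem1p5 (R : realType) (g : R) (hg : 0 < g) (k0 : R) (hk0 : 0 < k0) :
  exists (M : R) (h : R -> R),
    0 < M /\
    (forall p : R, 1 <= p -> sobolev_per (2 * pi / k0) 2 p h) /\
    (exists2 h3 : R -> R, weak_derivative (positivity_set h) 3 h h3 &
       Lp_loc (positivity_set h) 2 h3) /\
    weak_stationary_solution g M h /\
    (forall x : R, h (- x) = h x) /\
    periodic h (2 * pi / k0) /\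
    (forall x y : R, - (pi / k0) <= x -> x <= y -> y < 0 -> h x <= h y) /\
    (forall x : R, 0 <= h x) /\
    (forall x : R, h x = 0 <->
       exists j : int, x = pi / k0 + 2 * j%:~R * (pi / k0) \/
                       x = - (pi / k0) + 2 * j%:~R * (pi / k0)) /\
    (exists h1 h3 F : R -> R,
       [/\ film_derivatives h h1 h3,
           continuous F,
           forall x : R, positivity_set h x -> F x = flux g M h h1 h3 x &
           forall x : R, F x = 0]).
Proof.
have T0 : 0 < pi / k0 by rewrite divr_gt0// pi_gt0.
have [M gM hT] := exists_halfperiod hg T0.
have [X [theta H]] := exists_time hg gM.
have ch := continuous_film H; have ch1 := continuous_film1 hg gM H.
have c0 : continuous (cst 0 : R -> R) by move=> x; exact: cst_continuous.
have mc (f : R -> R) : continuous f -> measurable_fun setT f.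
  exact: continuous_measurable_fun.
have per : periodic (film theta) (2 * pi / k0).
  by move=> x; rewrite -mulrA -hT; exact: film_periodic H.
have w1 := weak_derivative_film1 hg gM H.
have w3 := weak_derivative_film3 hg gM H.
have sob p : 1 <= p -> sobolev_loc setT 2 p (film theta).
  move=> p1; have p0 : 0 < p by lra.
  case=> [|[|[|//]]] _.
  - exists (film theta); first exact: weak_derivative0 openT ch.
    by apply: Lp_loc_continuous => // [|x _]; [exact: mc|exact: ch].
  - exists (film1 g M theta) => //.
    by apply: Lp_loc_continuous => // [|x _]; [exact: mc|exact: ch1].
  - exists (film2 g M theta); first exact: weak_derivative_film2 H.
    exact: Lp_loc_film2 H p1.
have Lp3 : Lp_loc (positivity_set (film theta)) 2 (film3 g M theta).
  by apply: Lp_loc_continuous => // [|x Ux];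
    [exact: measurable_film3 H|exact: continuous_film3 H Ux].
exists M, (film theta); split; first exact: lt_trans gM.
split; first by move=> p p1; split; [exact: sob|].
split; first by exists (film3 g M theta).
split.
  split=> //.
    by move=> n n1; apply: (sob 2); [rewrite ler1n|exact: leq_trans n1 _].
  exists (film1 g M theta), (film3 g M theta); split => //.
    have -> : flux g M (film theta) (film1 g M theta) (film3 g M theta)
        \_ (positivity_set (film theta)) = cst 0.
      apply/funext => x; rewrite patchE; case: ifPn => // /set_mem.
      exact: flux_film.
    by apply: Lp_loc_continuous => // x _; exact: c0.
  (* The weak equation holds for every test function because its integrand already vanishes
     pointwise on {h > 0}. *)
  move=> phi dphi _; apply: integral0_eq => x hx.
  by rewrite flux_film// mul0r.
split; first by move=> x; exact: film_even H.
split=> //.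
split; first by move=> x y; rewrite -hT; exact: film_nondecreasing H.
split; first by move=> x; exact: sqr_ge0.
split.
  move=> x; rewrite (film_eq0 x H) hT; split.
    by move=> [j ->]; exists j; right; ring.
  move=> [j [->|->]]; last by exists j; ring.
  (* The right end of tile j is the left end of tile j + 1. *)
  by exists (j + 1); rewrite rmorphD/=; ring.
exists (film1 g M theta), (film3 g M theta), (cst 0); split => // x hx.
by rewrite flux_film.
Qed.
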